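(* Let $X$ be a finite regular cell complex whose vertex set is identified with $[n]=\{1,\dots,n\}$, and let $c=\dim X+1$. Then the category $\mathrm{CM}(X)$ has only a finite set of maximal objects, and these objects all lie in the subcategory $\mathrm{CM}_*(X)=\mathrm{CM}(X)\cap \mathrm{CM}_*(n,c)$.
   Context: Fix a field $k$; $\mathbb N$ contains $0$. Identify $k[x_1,\dots,x_r]$ with the semigroup ring $k[\mathbb N^r]$; for $\mathbf a\in\mathbb N^r$ write $\mathbf x^{\mathbf a}$ for the corresponding monomial. Category $\mathrm{Mon}(n)$: objects are pairs $(\mathbb N^r,\mathbf a)$ with $\mathbf a=(\mathbf a_1,\dots,\mathbf a_n)$ an $n$-tuple of elements of $\mathbb N^r$ such that no monomial $\mathbf x^{\mathbf a_i}$ divides another $\mathbf x^{\mathbf a_j}$, $i\ne j$. A morphism $(\mathbb N^r,\mathbf a)\to(\mathbb N^s,\mathbf b)$ is a semigroup (monoid) homomorphism $\phi:\mathbb N^r\to\mathbb N^s$ with $\phi(\mathbf a_i)=\mathbf b_i$ for all $i$. $\mathrm{CM}(n,c)$ is the full subcategory of those objects for which $k[x_1,\dots,x_r]/(\mathbf x^{\mathbf a_1},\dots,\mathbf x^{\mathbf a_n})$ is Cohen-Macaulay of codimension $c$. Given an object with all $\mathbf x^{\mathbf a_i}$ square free, associate to each variable $x_p$ the set $V_p\subseteq[n]$ of all $i$ such that $x_p$ divides $\mathbf x^{\mathbf a_i}$. $\mathrm{CM}_*(n,c)$ is the full subcategory of $\mathrm{CM}(n,c)$ of objects whose monomials are square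 free and whose subsets $V_p$ are pairwise distinct. $\mathrm{CM}(X)$: label vertex $i$ of $X$ by $m_i=\mathbf x^{\mathbf a_i}$ and each face $F$ (including the empty face) by the least common multiple $m_F$ of the labels of its vertices. The associated cellular complex over $S=k[x_1,\dots,x_r]$ has a free generator $e_F$ in homological degree $\dim F+1$ for each face $F$, with differential $e_F\mapsto\sum_G \mathrm{sign}(G,F)\,\frac{m_F}{m_G}e_G$ over the codimension one faces $G$ of $F$, $\mathrm{sign}$ being an incidence function of $X$. $\mathrm{CM}(X)$ is the full subcategory of $\mathrm{CM}(n,\dim X+1)$ of objects for which this complex is a minimal free resolution of $S/(m_1,\dots,m_n)$ (a ''CM monomial labelling'' of $X$). Maximal: an object $(\mathbb N^r,\mathbf a)$ of $\mathrm{CM}(X)$ is maximal if for every morphism $\phi:(\mathbb N^s,\mathbf b)\to(\mathbb N^r,\mathbf a)$ in $\mathrm{CM}(X)$, the map $\mathbb N^s\to\mathbb N^r$ is surjective and there is a splitting, i.e. a morphism $\psi:(\mathbb N^r,\mathbf a)\to(\mathbb N^s,\mathbf b)$ with $\phi\circ\psi=\mathrm{id}_{\mathbb N^r}$. *)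

(* Defs.v *)
From HB Require Import structures.
From mathcomp Require Import all_boot all_order all_algebra ring_quotient.
From mathcomp Require Import mpoly.
From mathcomp Require Import boolp classical_sets functions cardinality.
From mathcomp Require Import reals topology normedtype.

Set Implicit Arguments.
Unset Strict Implicit.
Unset Printing Implicit Defensive.

Import Order.TTheory GRing.Theory Num.Theory.
Import numFieldNormedType.Exports.

Local Open Scope classical_set_scope.
Local Open Scope ring_scope.

(** * Cohen-Macaulay quotient rings

    Prime and maximal ideals, heights and regular sequences of a quotient A/J
    are read in A: ideals of A/J are ideals of A containing J, and a sequence
    of elements of A/J is given by representatives.  The ring A/J is
    Cohen-Macaulay when depth(P, A/J) = height(P/J) for every maximal ideal P
    (Eisenbud, Commutative Algebra, section 18.2). *)

Section CohenMacaulay.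
Variable A : comNzRingType.
Implicit Types (B J P Q : set A) (f : seq A).

Definition ideal_gen B : set A :=
  [set x | exists s : seq (A * A),
     (forall p, p \in s -> B p.2) /\ x = \sum_(p <- s) p.1 * p.2].

Definition prime_ideal P : Prop :=
  idealr_closed (mem P) /\ prime_idealr_closed (mem P).

Definition maximal_ideal P : Prop :=
  idealr_closed (mem P) /\
  forall Q, idealr_closed (mem Q) -> P `<=` Q -> Q = P.

Definition height_ge J P (h : nat) : Prop :=
  exists C : nat -> set A,
    [/\ C h = P,
        forall i, (i <= h)%N -> prime_ideal (C i) /\ J `<=` C i
      & forall i, (i < h)%N -> C i `<` C i.+1].

(* The height of P/J in A/J; the height of P in A is the case J = [set 0]. *)
Definition height_eq J P (h : nat) : Prop :=
  height_ge J P h /\ forall h', height_ge J P h' -> (h' <= h)%N.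

Definition regular_seq J f : Prop :=
  (forall i, (i < size f)%N ->
     let K := ideal_gen (J `|` [set` take i f]) in
     forall x, K (f`_i * x) -> K x) /\
  ~ ideal_gen (J `|` [set` f]) 1.

Definition depth_eq J P (d : nat) : Prop :=
  (exists f, [/\ size f = d, [set` f] `<=` P & regular_seq J f]) /\
  forall f, [set` f] `<=` P -> regular_seq J f -> (size f <= d)%N.

Definition cohen_macaulay_quot J : Prop :=
  forall P, maximal_ideal P -> J `<=` P ->
    exists d, height_eq J P d /\ depth_eq J P d.

(* The codimension of A/J is the least height of a prime containing J. *)
Definition codim_eq J (c : nat) : Prop :=
  (exists P, [/\ prime_ideal P, J `<=` P & height_eq [set 0] P c]) /\
  forall P, prime_ideal P -> J `<=` P -> height_ge [set 0] P c.

End CohenMacaulay.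

(** * Finite regular cell complexes *)

Section Balls.
Variables (R : realType) (d : nat).

Definition closed_ball1 : set 'rV[R]_d := [set x | \sum_j x 0 j ^+ 2 <= 1].
Definition open_ball1 : set 'rV[R]_d := [set x | \sum_j x 0 j ^+ 2 < 1].
Definition sphere1 : set 'rV[R]_d := [set x | \sum_j x 0 j ^+ 2 = 1].

End Balls.

Definition homeo_onto_image (T U : topologicalType) (A : set T) (f : T -> U) :
    Prop :=
  {within A, continuous f} /\
  exists g : U -> T,
    {within f @` A, continuous g} /\ forall x, A x -> g (f x) = x.

(* A finite collection of balls in a Hausdorff space, whose interiors
   partition the space, and such that the boundary of each ball is a union of
   balls of the collection. *)
Record regular_cell_complex (R : realType) := RegularCellComplex {
  carrier : topologicalType;
  cell : finType;
  cell_dim : cell -> nat;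
  cell_map : forall e : cell, 'rV[R]_(cell_dim e) -> carrier;
  carrier_hausdorff : hausdorff_space carrier;
  cell_map_homeo :
    forall e, homeo_onto_image (@closed_ball1 R (cell_dim e)) (cell_map (e := e));
  cell_partition :
    forall x, exists! e, (cell_map (e := e) @` @open_ball1 R (cell_dim e)) x;
  cell_boundary :
    forall e, exists B : set cell,
      cell_map (e := e) @` @sphere1 R (cell_dim e) =
      \bigcup_(e' in B) (cell_map (e := e') @` @closed_ball1 R (cell_dim e'))
}.

Section Faces.
Variables (R : realType) (X : regular_cell_complex R).

(* None is the empty face. *)
Definition face : finType := option (cell X).

(* face_rank F = dim F + 1, the empty face having dimension -1. *)
Definition face_rank (F : face) : nat :=
  if F is Some e then (cell_dim e).+1 else 0%N.

Definition closed_face (F : face) : set (carrier X) :=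
  if F is Some e then
    cell_map (e := e) @` @closed_ball1 R (cell_dim e)
  else set0.

Definition is_face (G F : face) : bool := `[< closed_face G `<=` closed_face F >].

Definition facet (G F : face) : bool :=
  is_face G F && (face_rank F == (face_rank G).+1).

Definition dim_plus1 : nat := (\max_(F : face) face_rank F)%N.

(* sgn G F is the incidence number of G in F. *)
Definition incidence_function (sgn : face -> face -> int) : Prop :=
  [/\ forall G F, sgn G F \in [:: -1; 0; 1],
      forall G F, (sgn G F != 0) = facet G F,
      forall F, face_rank F = 1%N -> sgn None F = 1
    & forall H F G1 G2, G1 != G2 ->
        facet H G1 -> facet G1 F -> facet H G2 -> facet G2 F ->
        sgn H G1 * sgn G1 F + sgn H G2 * sgn G2 F = 0].

Definition vertex_identification (n : nat) (v : 'I_n -> cell X) : Prop :=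
  injective v /\ forall e, cell_dim e = 0%N <-> exists i, v i = e.

End Faces.

(** * Categories of monomial labellings *)

Record Mon (n : nat) := MonObj {
  nvars : nat;
  labels : n.-tuple 'X_{1..nvars};
  labels_antichain :
    [forall i, forall j, (i != j) ==> ~~ (tnth labels i <= tnth labels j)%MM]
}.

Section Categories.
Variable n : nat.

Definition label (O : Mon n) (i : 'I_n) : 'X_{1..nvars O} := tnth (labels O) i.

Definition Mon_morphism (O O' : Mon n)
    (phi : 'X_{1..nvars O} -> 'X_{1..nvars O'}) : Prop :=
  [/\ phi 0%MM = 0%MM,
      forall m m', phi (m + m')%MM = (phi m + phi m')%MM
    & forall i, phi (label O i) = label O' i].

Variable k : fieldType.

Definition label_ideal (O : Mon n) : set {mpoly k[nvars O]} :=
  ideal_gen (range (fun i => 'X_[label O i] : {mpoly k[nvars O]})).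

Definition in_CM (c : nat) (O : Mon n) : Prop :=
  cohen_macaulay_quot (@label_ideal O) /\ codim_eq (@label_ideal O) c.

Definition squarefree_labels (O : Mon n) : Prop :=
  forall i p, (label O i p <= 1)%N.

Definition var_support (O : Mon n) (p : 'I_(nvars O)) : {set 'I_n} :=
  [set i | (U_(p) <= label O i)%MM]%SET.

Definition in_CM_star (c : nat) (O : Mon n) : Prop :=
  [/\ in_CM c O, squarefree_labels O & injective (@var_support O)].

Variables (R : realType) (X : regular_cell_complex R).
Variables (v : 'I_n -> cell X) (sgn : face X -> face X -> int).

Section CellularComplex.
Variable O : Mon n.
Let r := nvars O.

Definition face_label (F : face X) : 'X_{1..r} :=
  \big[@mlcm r/0%MM]_(i < n | is_face (Some (v i)) F) label O i.

Definition rank_face (i : nat) : finType := {F : face X | face_rank F == i}.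

Definition empty_face : rank_face 0 :=
  exist (fun F : face X => face_rank F == 0%N) None (eqxx 0%N).

(* The free module with basis the faces F of dimension i - 1. *)
Definition chain (i : nat) := {ffun rank_face i -> {mpoly k[r]}}.

Definition boundary (i : nat) (u : chain i.+1) : chain i :=
  [ffun G => \sum_(F | facet (val G) (val F))
     (sgn (val G) (val F))%:~R
       * 'X_[(face_label (val F) - face_label (val G))%MM] * u F].

Definition cellular_resolution : Prop :=
  (forall u : chain 0,
     (exists w : chain 1, boundary w = u) <-> label_ideal (u empty_face)) /\
  (forall i (u : chain i.+1),
     boundary u = 0 <-> exists w : chain i.+2, boundary w = u).

Definition irrelevant_ideal : set {mpoly k[r]} :=
  ideal_gen (range (fun p : 'I_r => 'X_p : {mpoly k[r]})).

Definition minimal_complex : Prop :=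
  forall i (u : chain i.+1) G, irrelevant_ideal (boundary u G).

End CellularComplex.

Definition in_CMX (O : Mon n) : Prop :=
  [/\ in_CM (dim_plus1 X) O, cellular_resolution O & minimal_complex O].

Definition in_CMX_star (O : Mon n) : Prop :=
  in_CMX O /\ in_CM_star (dim_plus1 X) O.

Definition maximal_object (O : Mon n) : Prop :=
  in_CMX O /\
  forall O', in_CMX O' ->
  forall phi : 'X_{1..nvars O'} -> 'X_{1..nvars O}, Mon_morphism phi ->
    (forall m, exists m', phi m' = m) /\
    exists psi : 'X_{1..nvars O} -> 'X_{1..nvars O'},
      Mon_morphism psi /\ forall m, phi (psi m) = m.

End Categories.

(* Main.v *)
From HB Require Import structures.
Require Import Defs.
From mathcomp Require Import all_boot all_order all_algebra.
From mathcomp Require Import ring_quotient generic_quotient mxpoly.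
From mathcomp Require Import mpoly zify ring.
From mathcomp Require Import boolp classical_sets functions cardinality reals.

(* For a labelling O, let the levels of O be the distinct nonempty sets
   V_(p,j) = {i | j < a_i(p)} of vertices.  The polarization of O, with one
   variable for each level and the i-th label the product of the levels that
   contain i, is square free, has distinct supports, and maps to O by sending a
   level V to the product of the x_p over all (p, j) with V_(p,j) = V.  For every
   monomial m' the faces of X whose polarized label divides m' are those whose
   label divides some monomial m; as exactness of the cellular complex only
   depends on these subcomplexes, the polarization is resolved by X as well.
   Its codimension is unchanged, both being the least size of a set of variables
   meeting all labels, and a resolution as long as the codimension makes the
   quotient Cohen-Macaulay.  So the polarization lies in CM(X), and if O is
   maximal then O splits off it, which forces O to be square free with distinct
   supports.  Such objects have at most 2^n variables, so they are finitely many.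

   For the Cohen-Macaulay property at a maximal ideal P of S = k[x_1, ..., x_r]:
   by the Nullstellensatz P contains nonzero univariate polynomials g_j(x_j),
   which form a regular sequence.  If f_1, ..., f_m is S-regular in P and S/I has
   a free resolution of length c < m, then S/I has no nonzero element killed by
   P; prime avoidance gives x in P regular on S/I and on all S/(f_1, ..., f_i)
   with i < m, and one passes to S/x with f_1, ..., f_(m-1).  This yields an
   S/I-regular sequence of length r - c in P, while chains of primes of S have
   length at most r. *)

Set Implicit Arguments.
Unset Strict Implicit.
Unset Printing Implicit Defensive.

Import Order.TTheory GRing.Theory Num.Theory.

Local Open Scope classical_set_scope.
Local Open Scope ring_scope.

(** * Ideals and Noetherian rings *)

Section Ideals.
Variable A : comNzRingType.
Implicit Types (B I J P Q : set A) (s : seq A).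

Definition is_ideal I :=
  [/\ I 0, forall x y, I x -> I y -> I (x + y) & forall a x, I x -> I (a * x)].

Lemma is_idealN I x : is_ideal I -> I x -> I (- x).
Proof. by case=> _ _ IM Ix; rewrite -mulN1r; exact: IM. Qed.

Lemma is_idealB I x y : is_ideal I -> I x -> I y -> I (x - y).
Proof. by move=> idI Ix Iy; case: (idI) => _ ID _; apply: ID => //; exact: is_idealN. Qed.

Lemma is_ideal_sum I (T : Type) (r : seq T) (p : pred T) (F : T -> A) :
  is_ideal I -> (forall i, p i -> I (F i)) -> I (\sum_(i <- r | p i) F i).
Proof. by case=> I0 ID _ IF; elim/big_ind: _. Qed.

Lemma is_ideal_shift I x y : is_ideal I -> I (x - y) -> I y -> I x.
Proof. by move=> [_ ID _] Ixy Iy; rewrite -(subrK y x); exact: ID. Qed.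

Lemma is_ideal_idealr P : idealr_closed (mem P) -> is_ideal P.
Proof.
case=> /set_mem P0 _ PD; split => //.
  move=> x y Px Py; rewrite -(mul1r x); apply/set_mem.
  by apply: PD; apply/mem_set.
move=> a x Px; rewrite -(addr0 (a * x)); apply/set_mem.
by apply: PD; apply/mem_set.
Qed.

Lemma idealr_closedP P : idealr_closed (mem P) <-> is_ideal P /\ ~ P 1.
Proof.
split=> [iP|[[P0 PD PM] P1]].
  split; first exact: is_ideal_idealr.
  by case: iP => _ /negP P1 _ P1'; apply: P1; exact/mem_set.
split; first exact/mem_set.
  by apply/negP => /set_mem.
by move=> a u w /set_mem Pu /set_mem Pv; apply/mem_set/PD => //; exact: PM.
Qed.

Lemma ideal_gen_is_ideal B : is_ideal (ideal_gen B).
Proof.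
split.
- by exists [::]; rewrite big_nil.
- move=> _ _ [s [sB ->]] [t [tB ->]]; exists (s ++ t); rewrite big_cat; split=> //.
  by move=> p; rewrite mem_cat => /orP[/sB|/tB].
- move=> a _ [s [sB ->]]; exists [seq (a * p.1, p.2) | p <- s]; split.
    by move=> _ /mapP[p /sB Bp ->].
  by rewrite big_map mulr_sumr; apply: eq_bigr => p _; rewrite mulrA.
Qed.

Lemma sub_ideal_gen B : B `<=` ideal_gen B.
Proof.
move=> x Bx; exists [:: (1, x)]; split; last by rewrite big_seq1 mul1r.
by move=> p; rewrite inE => /eqP ->.
Qed.

Lemma ideal_gen_min B I : is_ideal I -> B `<=` I -> ideal_gen B `<=` I.
Proof.
move=> idI BI _ [s [sB ->]]; rewrite big_seq; apply: is_ideal_sum => // p /sB.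
by case: (idI) => _ _ IM /BI; exact: IM.
Qed.

Lemma ideal_gen_mono B I : B `<=` I -> ideal_gen B `<=` ideal_gen I.
Proof.
move=> BI; apply: ideal_gen_min; first exact: ideal_gen_is_ideal.
by apply: subset_trans (@sub_ideal_gen I).
Qed.

Lemma ideal_gen_id I : is_ideal I -> ideal_gen I = I.
Proof. by move=> idI; apply/seteqP; split; [exact: ideal_gen_min|exact: sub_ideal_gen]. Qed.

Lemma ideal_gen_set0 : ideal_gen (set0 : set A) = [set 0].
Proof.
apply/seteqP; split; last by move=> _ ->; case: (ideal_gen_is_ideal set0).
apply: ideal_gen_min => //; split => //.
  by move=> _ _ -> ->; rewrite /= addr0.
by move=> a _ ->; rewrite /= mulr0.
Qed.

Lemma is_ideal0 : is_ideal [set 0 : A].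
Proof. by rewrite -ideal_gen_set0; exact: ideal_gen_is_ideal. Qed.

Lemma ideal_genUr B I : ideal_gen (B `|` ideal_gen I) = ideal_gen (B `|` I).
Proof.
apply/seteqP; split; last first.
  by apply: ideal_gen_mono => x [|/sub_ideal_gen]; [left|right].
apply: ideal_gen_min; first exact: ideal_gen_is_ideal.
move=> x [Bx|]; first by apply: sub_ideal_gen; left.
by apply: ideal_gen_mono => y; right.
Qed.

Lemma ideal_genUl B I : ideal_gen (ideal_gen B `|` I) = ideal_gen (B `|` I).
Proof. by rewrite setUC ideal_genUr setUC. Qed.

Definition adjoin I f : set A := [set x | exists a, I (x - a * f)].

Lemma adjoin_is_ideal I f : is_ideal I -> is_ideal (adjoin I f).
Proof.
move=> idI; case: (idI) => I0 ID IM; split.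
- by exists 0; rewrite mul0r subr0.
- move=> x y [a Ia] [b Ib]; exists (a + b).
  by rewrite mulrDl opprD addrACA; exact: ID.
- by move=> a x [b Ib]; exists (a * b); rewrite -mulrA -mulrBr; exact: IM.
Qed.

Lemma sub_adjoin I f : I `<=` adjoin I f.
Proof. by move=> x Ix; exists 0; rewrite mul0r subr0. Qed.

Lemma mem_adjoin I f a : is_ideal I -> adjoin I f (a * f).
Proof. by case=> I0 _ _; exists a; rewrite subrr. Qed.

Lemma adjoin_min I Q f : is_ideal Q -> I `<=` Q -> Q f -> adjoin I f `<=` Q.
Proof.
move=> idQ IQ Qf x [a /IQ]; move/is_ideal_shift; apply => //.
by case: idQ => _ _; exact.
Qed.

Lemma ideal_gen_set1 I f : is_ideal I -> ideal_gen (I `|` [set f]) = adjoin I f.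
Proof.
move=> idI; apply/seteqP; split.
  apply: ideal_gen_min; first exact: adjoin_is_ideal.
  move=> x [|->]; first exact: sub_adjoin.
  by have := mem_adjoin f 1 idI; rewrite mul1r.
apply: adjoin_min; first exact: ideal_gen_is_ideal.
  by move=> x Ix; apply: sub_ideal_gen; left.
by apply: sub_ideal_gen; right.
Qed.

End Ideals.

Section Noetherian.
Variable A : comNzRingType.

Definition noetherian := forall p : nat -> A,
  exists N, ideal_gen (p @` `I_N) (p N).

Hypothesis nA : noetherian.

(** Otherwise dependent choice gives a strictly increasing sequence of ideals, and elements p_n of
    the (n+1)-st outside the n-th contradict [noetherian]. *)
Lemma noetherian_max (F : set (set A)) I0 : (forall I, F I -> is_ideal I) ->
  F I0 -> exists M, [/\ F M, I0 `<=` M & forall I, F I -> M `<=` I -> I `<=` M].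
Proof.
move=> idF FI0; apply: contrapT => noM.
pose T := {I | F I /\ I0 `<=` I}.
have nxt (M : T) : {M' : T | sval M `<=` sval M' /\ exists x, sval M' x /\ ~ sval M x}.
  apply: cid; case: M => M [FM IM] /=; apply: contrapT => noM'.
  apply: noM; exists M; split => // I FI MI x Ix; apply: contrapT => nMx.
  apply: noM'; exists (exist _ I (conj FI (subset_trans IM MI))); split => //=.
  by exists x.
have [f [_ fS]] := dependent_choice nxt (exist _ I0 (conj FI0 (@subset_refl _ I0))).
have [p pP] := choice (fun n => (fS n).2).
have [N pN] := nA p.
have idf n : is_ideal (sval (f n)) by case: (f n) => I [] /= /idF.
have fm n m : (n <= m)%N -> sval (f n) `<=` sval (f m).
  move=> /subnK <-; elim: (m - n)%N => // d IH.
  by apply: subset_trans IH _; have [] := fS (d + n)%N.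
have [_ nf] := pP N; apply: nf; move: pN; apply: ideal_gen_min => //.
move=> _ [i /= iN <-]; apply: (fm i.+1 N) => //; by have [] := pP i.
Qed.

Lemma noetherian_fg (B : set A) :
  exists s : seq A, [set` s] `<=` B /\ B `<=` ideal_gen [set` s].
Proof.
pose F := [set I | exists s : seq A, [set` s] `<=` B /\ I = ideal_gen [set` s]].
have := @noetherian_max F (ideal_gen [set` ([::] : seq A)]).
case.
- by move=> _ [s [_ ->]]; exact: ideal_gen_is_ideal.
- by exists [::].
- move=> _ [[s [sB ->]] _ Ms]; exists s; split=> // x Bx.
  apply: (Ms (ideal_gen [set` x :: s])).
  + exists (x :: s); split=> //= y /=; rewrite inE => /orP[/eqP -> //|].
    exact: sB.
  + by apply: ideal_gen_mono => y /= ys; rewrite inE ys orbT.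
  + by apply: sub_ideal_gen; rewrite /= inE eqxx.
Qed.

End Noetherian.

Lemma noetherian_image (A B : comNzRingType) (f : {rmorphism A -> B}) :
  noetherian A -> (forall b, exists a, f a = b) -> noetherian B.
Proof.
move=> nA fs p; have [q qP] := choice (fun n => fs (p n)).
have [N [s [sq eN]]] := nA q; exists N.
exists [seq (f t.1, f t.2) | t <- s]; split.
  move=> _ /mapP[t /sq [i iN <-] ->] /=; exists i => //; by rewrite qP.
rewrite big_map -qP eN rmorph_sum; apply: eq_bigr => i _; exact: rmorphM.
Qed.

Lemma noetherian_field (k : fieldType) : noetherian k.
Proof.
move=> p; have [p0|p0] := eqVneq (p 0%N) 0.
  exists 0%N; rewrite p0; by case: (ideal_gen_is_ideal (p @` `I_0)).
exists 1%N; have [_ _ IM] := ideal_gen_is_ideal (p @` `I_1).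
rewrite -(divfK p0 (p 1%N)); apply: IM; apply: sub_ideal_gen.
by exists 0%N.
Qed.

Lemma ideal_gen_range (A : comNzRingType) (p : nat -> A) x :
  ideal_gen (range p) x -> exists N, ideal_gen (p @` `I_N) x.
Proof.
move=> [s [sp ->]]; elim: s sp => [|t s IH] sp.
  by exists 0%N; rewrite big_nil; case: (ideal_gen_is_ideal (p @` `I_0)).
have [|N IN] := IH; first by move=> u us; apply: sp; rewrite inE us orbT.
have [i _ pi] := sp t (mem_head _ _).
exists (maxn i.+1 N); rewrite big_cons.
have [_ ID IM] := ideal_gen_is_ideal (p @` `I_(maxn i.+1 N)); apply: ID.
  by rewrite -pi; apply/IM/sub_ideal_gen; exists i => //=; rewrite leq_maxl.
move: IN; apply: ideal_gen_mono => _ [j /= jN <-]; exists j => //=.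
by rewrite (leq_trans jN)// leq_maxr.
Qed.

(* Hilbert's basis theorem: pick f_n of minimal degree outside the ideal
   generated by the previous ones; the leading coefficient of some f_n lies in
   the ideal of the previous leading coefficients, and f_n can be reduced. *)
Lemma noetherian_poly (A : comNzRingType) : noetherian A -> noetherian {poly A}.
Proof.
move=> nA p; apply: contrapT => noN.
have pN N : ~ ideal_gen (p @` `I_N) (p N) by move=> h; apply: noN; exists N.
pose I := ideal_gen (range p); have idI : is_ideal I := ideal_gen_is_ideal _.
pose T := {s : seq {poly A} | [set` s] `<=` I}.
pose minout (s : seq {poly A}) f := [/\ I f, ~ ideal_gen [set` s] f &
  forall g, I g -> ~ ideal_gen [set` s] g -> (size f <= size g)%N].
have nxt (s : T) : {t : T | exists f, sval t = f :: sval s /\ minout (sval s) f}.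
  apply: cid; case: s => s sI /=.
  have [N sN] : exists N, [set` s] `<=` ideal_gen (p @` `I_N).
    elim: s sI => [|f s IH] sI; first by exists 0%N.
    have [|N sN] := IH; first by move=> g /= gs; apply: sI => /=; rewrite inE gs orbT.
    have [|M fM] := @ideal_gen_range _ p f; first by apply: sI; rewrite /= mem_head.
    have mono a b : (a <= b)%N -> ideal_gen (p @` `I_a) `<=` ideal_gen (p @` `I_b).
      move=> ab; apply: ideal_gen_mono => _ [i /= ia <-]; exists i => //=.
      exact: leq_trans ia ab.
    exists (maxn M N) => g /=; rewrite inE => /orP[/eqP ->|gs].
      exact: mono (leq_maxl _ _) _ fM.
    exact: mono (leq_maxr _ _) _ (sN _ gs).
  pose D := [set n | exists g, [/\ I g, ~ ideal_gen [set` s] g & size g = n]].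
  have D0 : exists n, `[< D n >].
    exists (size (p N)); apply/asboolP; exists (p N); split => //.
      by apply: sub_ideal_gen; exists N.
    move=> gN; apply: (pN N); move: gN; apply: ideal_gen_min => //.
    exact: ideal_gen_is_ideal.
  case: (ex_minnP D0) => m /asboolP [f [If nf fm]] mP.
  have fI : [set` f :: s] `<=` I.
    by move=> g /=; rewrite inE => /orP[/eqP -> //|]; exact: sI.
  exists (exist _ (f :: s) fI), f; split=> //; split=> // g Ig ng.
  by rewrite fm; apply: mP; apply/asboolP; exists g.
have n0 : [set` ([::] : seq {poly A})] `<=` I by [].
have [c [c0 cS]] := dependent_choice nxt (exist _ [::] n0).
have [f fP] := choice cS.
have cE n : [set` sval (c n)] = f @` `I_n.
  elim: n => [|n IH]; first by rewrite c0 /=; apply/seteqP; split => // x [].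
  have [-> _] := fP n; apply/seteqP; split=> x /=.
    rewrite inE => /orP[/eqP ->|xc]; first by exists n => /=.
    have : (f @` `I_n) x by rewrite -IH.
    by move=> [i /= /ltnW ? <-]; exists i.
  move=> [i /= ]; rewrite ltnS leq_eqVlt => /orP[/eqP -> <-|iN <-].
    by rewrite mem_head.
  have : (f @` `I_n) (f i) by exists i.
  by rewrite -IH /= inE => ->; rewrite orbT.
have fmin n : minout (sval (c n)) (f n) by have [] := fP n.
have [N [s [sf fN]]] := nA (fun n => lead_coef (f n)).
have [IfN nfN fNmin] := fmin N.
rewrite cE in nfN fNmin.
have [i iP] : exists i : A * A -> nat, forall t, t \in s ->
    (i t < N)%N /\ lead_coef (f (i t)) = t.2.
  have /choice [i iP] : forall t, exists j, t \in s -> (j < N)%N /\ lead_coef (f j) = t.2.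
    move=> t; case: (boolP (t \in s)) => [/sf [j jN e]|_]; last by exists 0%N.
    by exists j.
  by exists i.
have fsz j : (j < N)%N -> (size (f j) <= size (f N))%N.
  move=> jN; have [_ _] := fmin j; apply=> //; rewrite cE => h; apply: nfN.
  move: h; apply: ideal_gen_mono => _ [l /= lj <-]; exists l => //=.
  exact: ltn_trans lj jN.
(* [g] has at most the size of [f N] and the same top coefficient, so [f N - g] is smaller but still
   outside the ideal of the earlier terms, against the minimality of [f N]. *)
pose g := \sum_(t <- s) (t.1%:P * 'X^(size (f N) - size (f (i t)))) * f (i t).
have gI : ideal_gen (f @` `I_N) g.
  rewrite /g big_seq; apply: is_ideal_sum; first exact: ideal_gen_is_ideal.
  move=> t /iP [iN _]; have [_ _ IM] := ideal_gen_is_ideal (f @` `I_N).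
  by apply: IM; apply: sub_ideal_gen; exists (i t).
have fN0 : f N != 0.
  by apply/negP => /eqP f0; apply: nfN; rewrite f0; case: (ideal_gen_is_ideal (f @` `I_N)).
have sg : (size g <= size (f N))%N.
  rewrite /g big_seq; apply: (leq_trans (size_sum _ _ _)).
  apply/bigmax_leqP_seq => t ts _; rewrite -mulrA mul_polyC.
  apply: (leq_trans (size_scale_leq _ _)).
  apply: (leq_trans (size_polyMleq _ _)); rewrite size_polyXn.
  by rewrite addSn /= subnK// fsz//; have [] := iP _ ts.
have lg : g`_(size (f N)).-1 = lead_coef (f N).
  rewrite fN /g coef_sum big_seq [RHS]big_seq; apply: eq_bigr => t ts.
  have [iN <-] := iP _ ts; rewrite -mulrA coefCM coefXnM; congr (_ * _).
  have szf : (0 < size (f (i t)))%N.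
    rewrite size_poly_gt0; apply/negP => /eqP f0; have [_ nf _] := fmin (i t).
    by apply: nf; rewrite f0; case: (ideal_gen_is_ideal [set` sval (c (i t))]).
  have le := fsz _ iN.
  have sN0 : (0 < size (f N))%N by rewrite size_poly_gt0.
  rewrite lead_coefE; case: ifP => [|_]; first by lia.
  congr (_`_ _); lia.
have /fNmin : I (f N - g).
  apply: is_idealB => //; move: gI; apply: ideal_gen_min => // _ [j _ <-].
  by have [] := fmin j.
have nout : ~ ideal_gen (f @` `I_N) (f N - g).
  by move=> h; apply: nfN; apply: is_ideal_shift h gI; exact: ideal_gen_is_ideal.
move=> /(_ nout); apply/negP; rewrite -ltnNge.
have sN0 : (0 < size (f N))%N by rewrite size_poly_gt0.
rewrite -(prednK sN0) ltnS; apply/leq_sizeP => j; rewrite leq_eqVlt.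
move=> /orP[/eqP <-|jN]; first by rewrite coefB lg lead_coefE subrr.
have {jN} : (size (f N) <= j)%N by rewrite -(prednK sN0).
move=> jN; rewrite coefB !nth_default ?subrr//; exact: leq_trans sg jN.
Qed.

(** * Primes, zero divisors and regular sequences *)

Section Primes.
Variable A : comNzRingType.
Implicit Types (I J P Q : set A) (f : seq A).

Lemma prime_idealP P : prime_ideal P <->
  [/\ is_ideal P, ~ P 1 & forall u v, P (u * v) -> P u \/ P v].
Proof.
split=> [[/idealr_closedP [idP P1] pP]|[idP P1 pP]].
  split=> // u v Puv; have := pP u v (mem_set Puv).
  by move=> /orP[/set_mem|/set_mem]; [left|right].
split; first exact/idealr_closedP.
move=> u v /set_mem /pP [Pu|Pv]; apply/orP; [left|right]; exact: mem_set.
Qed.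

Lemma prime_ideal_exp P x n : prime_ideal P -> P (x ^+ n) -> P x.
Proof.
move=> /prime_idealP [_ P1 pP]; elim: n => [|n IH]; first by rewrite expr0.
by rewrite exprS => /pP [].
Qed.

Lemma prime_ideal_prod P (T : eqType) (r : seq T) (F : T -> A) :
  prime_ideal P -> P (\prod_(i <- r) F i) -> exists2 i, i \in r & P (F i).
Proof.
move=> /prime_idealP [_ P1 pP]; elim: r => [|i r IH]; first by rewrite big_nil.
rewrite big_cons => /pP [Pi|/IH [j jr Pj]]; first by exists i => //; exact: mem_head.
by exists j => //; rewrite inE jr orbT.
Qed.

Lemma maximal_prime P : maximal_ideal P -> prime_ideal P.
Proof.
move=> [/idealr_closedP [idP P1] mP]; apply/prime_idealP; split=> // u v Puv.
apply: contrapT => /not_orP [nu nv].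
have h x : ~ P x -> exists a, P (1 - a * x).
  move=> nx; apply: contrapT => na; apply: nx.
  rewrite -(mP (adjoin P x)); last 2 first.
  - by apply/idealr_closedP; split; [exact: adjoin_is_ideal|].
  - exact: sub_adjoin.
  by have := mem_adjoin x 1 idP; rewrite mul1r.
have [a Pa] := h _ nu; have [b Pb] := h _ nv; apply: P1.
have [_ PD PM] := idP.
have -> : 1 = (1 - b * v) + (b * v) * (1 - a * u) + (a * b) * (u * v) by ring.
by apply: (PD); [apply: (PD) => //|]; apply: PM.
Qed.

Definition colon J u : set A := [set x | J (x * u)].

(** The annihilator of u in A/J is maximal among those of nonzero classes; such annihilators are
    associated primes of A/J. *)
Definition max_colon J u := ~ J u /\
  forall w, ~ J w -> colon J u `<=` colon J w -> colon J w `<=` colon J u.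

Lemma colon_is_ideal J u : is_ideal J -> is_ideal (colon J u).
Proof.
case=> J0 JD JM; split.
- by rewrite /colon /= mul0r.
- by move=> x y; rewrite /colon /= mulrDl; exact: JD.
- by move=> a x; rewrite /colon /= -mulrA; exact: JM.
Qed.

(** If x y kills u and y u is nonzero modulo J, the annihilator of y u contains that of u, hence
    equals it, and contains x. *)
Lemma max_colon_prime J u : is_ideal J -> max_colon J u -> prime_ideal (colon J u).
Proof.
move=> idJ [nu mu]; apply/prime_idealP; split; first exact: colon_is_ideal.
  by rewrite /colon /= mul1r.
move=> x y; rewrite /colon /= => Jxy.
have [Jyu|nyu] := pselect (J (y * u)); first by right.
left; apply: (mu (y * u)) => //; last by rewrite /colon /= mulrA.
move=> z; rewrite /colon /= mulrCA => Jzu; case: idJ => _ _; exact.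
Qed.

(** Induction on the number of primes gives, for each i, some x_i in P outside all p_j with j <> i.
    If every x_i lies in p_i, the last one plus the product of the others avoids all primes. *)
Lemma prime_avoidance P (m : nat) (p : nat -> set A) : is_ideal P ->
  (forall i, (i < m)%N -> prime_ideal (p i)) ->
  (forall i, (i < m)%N -> ~ P `<=` p i) ->
  exists x, P x /\ forall i, (i < m)%N -> ~ p i x.
Proof.
move=> idP; have [P0 PD PM] := idP; elim: m p => [|m IH] p pp Pp.
  by exists 0.
case: m IH pp Pp => [|m] IH pp Pp.
  have /existsNP [x /not_implyP [Px nx]] := Pp 0%N isT.
  by exists x; split=> // -[].
have bumpm i j : (j < m.+1)%N -> (bump i j < m.+2)%N.
  by move=> jm; rewrite -addnS /bump; case: (i <= j)%N => //=; lia.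
have /choice [x xP] : forall i, exists x, P x /\
    forall j, (j < m.+1)%N -> ~ p (bump i j) x.
  by move=> i; apply: IH => j jm; [apply: pp|apply: Pp]; exact: bumpm.
have xne i j : (i < m.+2)%N -> (j < m.+2)%N -> j != i -> ~ p j (x i).
  move=> im jm ji; have <- : bump i (unbump i j) = j.
    by rewrite unbumpKcond (negbTE ji).
  have [_] := xP i; apply; rewrite /unbump; move: ji.
  by case: (ltngtP i j) => //= ij _; rewrite ?subn0; lia.
have [[i [im nx]]|nx] := pselect (exists i, (i < m.+2)%N /\ ~ p i (x i)).
  exists (x i); split; first by have [] := xP i.
  by move=> j jm; have [->//|ji] := eqVneq j i; apply: xne.
have xi i : (i < m.+2)%N -> p i (x i).
  by move=> im; apply: contrapT => n; apply: nx; exists i.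
exists (x m.+1 + \prod_(i < m.+1) x i); split.
  apply: PD; first by have [] := xP m.+1.
  by rewrite big_ord_recl mulrC; apply: PM; have [] := xP 0%N.
move=> i; rewrite ltnS leq_eqVlt => /orP[/eqP ->|im].
  have pm := pp m.+1 (ltnSn _); have /prime_idealP [idp _ _] := pm.
  move=> h; have : p m.+1 (\prod_(i < m.+1) x i).
    rewrite -[X in p _ X](addKr (x m.+1)) addrC; apply: is_idealB => //.
    exact: xi.
  move=> /(prime_ideal_prod pm) [j _]; apply: xne => //; have := ltn_ord j; lia.
have im2 : (i < m.+2)%N by apply: ltnW.
have /prime_idealP [idp _ _] := pp i im2; have [_ _ pM] := idp.
move=> h; apply: (xne m.+1 i) => //; first by rewrite ltn_eqF.
rewrite -[x m.+1](addrK (\prod_(i < m.+1) x i)); apply: is_idealB => //.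
by rewrite (bigD1 (Ordinal im)) //= mulrC; apply: pM; exact: xi.
Qed.

Definition nonzerodiv J x := forall u, J (x * u) -> J u.

(** No nonzero element of A/J is killed by P; over a Noetherian ring this provides a nonzero divisor
    on A/J inside P. *)
Definition socle_free P J := forall u, (forall x, P x -> J (x * u)) -> J u.

Hypothesis nA : noetherian A.

Lemma max_colon_ex J x u : is_ideal J -> J (x * u) -> ~ J u ->
  exists w, max_colon J w /\ J (x * w).
Proof.
move=> idJ Jxu nu.
have [||M [[w [nw ->]] uM Mm]] :=
    @noetherian_max _ nA [set I | exists w, ~ J w /\ I = colon J w] (colon J u).
- by move=> _ [w [_ ->]]; exact: colon_is_ideal.
- by exists u.
exists w; split; last exact: uM.
by split=> // z nz; apply: Mm; exists z.
Qed.

(** Take finitely many generators, of maximal annihilator, of the ideal spanned by all such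
    elements. If none of their annihilators is contained in that of u, choose x_t killing t but not
    u; the product of the x_t kills every t, hence u, so the prime [colon J u] contains some x_t. *)
Lemma max_colon_finite J : is_ideal J -> exists s : seq A,
  (forall t, t \in s -> max_colon J t) /\
  forall u, max_colon J u -> exists2 t, t \in s & colon J t `<=` colon J u.
Proof.
move=> idJ; have [s [sB Bs]] := noetherian_fg nA [set u | max_colon J u].
exists s; split; first by move=> t; exact: sB.
move=> u mu; apply: contrapT => nt.
have /choice [x xP] : forall t, exists x, t \in s -> J (x * t) /\ ~ J (x * u).
  move=> t; case: (boolP (t \in s)) => [ts|_]; last by exists 0.
  apply: contrapT => nx; apply: nt; exists t => // y yt.
  by apply: contrapT => nyu; apply: nx; exists y.
have [_ _ JM] := idJ.
have Ju : J ((\prod_(t <- s) x t) * u).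
  pose K : set A := [set y | J ((\prod_(t <- s) x t) * y)].
  have idK : is_ideal K.
    have [J0 JD _] := idJ; split.
    - by rewrite /K /= mulr0.
    - by move=> y z; rewrite /K /= mulrDr; exact: JD.
    - by move=> a y; rewrite /K /= mulrCA; exact: JM.
  have := Bs u mu; apply: (ideal_gen_min idK) => t /= ts.
  rewrite /K /= (big_rem t) //= mulrAC mulrC; apply: JM.
  by have [] := xP t ts.
have [t ts xt] := prime_ideal_prod (max_colon_prime idJ mu) Ju.
by have [] := xP t ts.
Qed.

(** A zero divisor on A/J kills some element with maximal annihilator, and these annihilators are
    finitely many primes. None contains P, for P would then kill a nonzero element; prime avoidance
    treats all the [J i] at once. *)
Lemma avoid_zero_divisors P (m : nat) (J : nat -> set A) : is_ideal P ->
  (forall i, (i < m)%N -> is_ideal (J i) /\ socle_free P (J i)) ->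
  exists x, P x /\ forall i, (i < m)%N -> nonzerodiv (J i) x.
Proof.
move=> idP JP.
have /choice [s sP] : forall i, exists s : seq A, (i < m)%N ->
    (forall t, t \in s -> max_colon (J i) t) /\
    forall u, max_colon (J i) u ->
      exists2 t, t \in s & colon (J i) t `<=` colon (J i) u.
  move=> i; case: (ltnP i m) => [im|_]; last by exists [::].
  by have [s sP] := max_colon_finite (JP i im).1; exists s.
pose L := [seq (i, t) | i <- iota 0 m, t <- s i].
pose p n := let: (i, t) := nth (0%N, 0) L n in colon (J i) t.
have LP n : (n < size L)%N -> exists i t,
    [/\ (i < m)%N, p n = colon (J i) t & max_colon (J i) t].
  move=> nL; have := mem_nth (0%N, 0) nL; rewrite /p.
  move=> /allpairsPdep [i [t [+ ts e]]]; rewrite mem_iota add0n => /andP[_ im].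
  exists i, t; rewrite e; split=> //; exact: (sP i im).1.
have [|n nL|x [Px xn]] := @prime_avoidance P (size L) p idP.
- move=> n /LP [i [t [im -> mt]]]; apply: max_colon_prime => //.
  exact: (JP i im).1.
- have [i [t [im -> mt]]] := LP n nL => Pt.
  by apply: (mt.1); apply: (JP i im).2 => y /Pt.
exists x; split=> // i im u Jxu; apply: contrapT => nu.
have [w [mw Jxw]] := max_colon_ex (JP i im).1 Jxu nu.
have [t ts tw] := (sP i im).2 w mw.
have itL : (i, t) \in L by apply/allpairsPdep; exists i, t; rewrite mem_iota.
apply: (xn (index (i, t) L)); first by rewrite index_mem.
rewrite /p nth_index //.
apply: (proj2 ((sP i im).1 t ts) w mw.1 tw); exact: Jxw.
Qed.

(** Q is maximal among the ideals missing all x^n s with s outside P: n = 0 puts Q inside P, and s =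
    1 keeps x out of Q. J misses this multiplicative set because x is regular on A/J and J lies in
    P. *)
Lemma prime_below J P x : is_ideal J -> prime_ideal P -> J `<=` P ->
  nonzerodiv J x -> exists Q, [/\ prime_ideal Q, J `<=` Q, Q `<=` P & ~ Q x].
Proof.
move=> idJ pP JP xJ; have /prime_idealP [idP P1 PM] := pP.
pose F : set (set A) := [set I | is_ideal I /\
   forall n s, ~ P s -> ~ I (x ^+ n * s)].
have xnJ n s : J (x ^+ n * s) -> J s.
  by elim: n => [|n IH]; rewrite ?expr0 ?mul1r// exprS -mulrA => /xJ.
have [||Q [[idQ QF] JQ Qmax]] := @noetherian_max _ nA F J.
- by move=> I [].
- by split=> // n s ns /xnJ /JP.
have QP : Q `<=` P.
  by move=> y Qy; apply: contrapT => /(QF 0%N); rewrite expr0 mul1r.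
exists Q; split=> //; last by have := QF 1%N 1 P1; rewrite expr1 mulr1.
apply/prime_idealP; split=> //; first by move=> /QP.
move=> u v Quv; apply: contrapT => /not_orP [nu nv].
have out w : ~ Q w -> exists n s, ~ P s /\ adjoin Q w (x ^+ n * s).
  move=> nw; apply: contrapT => nex; apply: nw.
  apply: (Qmax (adjoin Q w)).
  - split; first exact: adjoin_is_ideal.
    by move=> n s ns h; apply: nex; exists n, s.
  - exact: sub_adjoin.
  - by have := mem_adjoin w 1 idQ; rewrite mul1r.
have [n [s [ns [a Qa]]]] := out _ nu; have [m [t [nt [b Qb]]]] := out _ nv.
apply: (QF (n + m)%N (s * t)); first by move=> /PM [].
have [_ QD QM] := idQ.
have -> : x ^+ (n + m) * (s * t) = (x ^+ m * t) * (x ^+ n * s - a * u)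
   + (a * u) * (x ^+ m * t - b * v) + (a * b) * (u * v).
  by rewrite exprD; ring.
by apply: (QD); [apply: (QD)|]; apply: QM.
Qed.

(* The first half of [regular_seq]: properness is dropped. *)
Fixpoint wregular J f : Prop :=
  if f is x :: f' then nonzerodiv J x /\ wregular (adjoin J x) f' else True.

Lemma ideal_gen_cons J x f : is_ideal J ->
  ideal_gen (J `|` [set` x :: f]) = ideal_gen (adjoin J x `|` [set` f]).
Proof.
move=> idJ; rewrite -(ideal_gen_set1 _ idJ) ideal_genUl -setUA; congr (ideal_gen (_ `|` _)).
apply/seteqP; split=> y /=; first by rewrite inE => /orP[/eqP|]; [left|right].
by move=> [->|yf]; rewrite inE ?eqxx// yf orbT.
Qed.

Lemma regular_seqP J f : is_ideal J ->
  regular_seq J f <-> wregular J f /\ ~ ideal_gen (J `|` [set` f]) 1.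
Proof.
rewrite /regular_seq => idJ.
suff : (forall i, (i < size f)%N ->
     let K := ideal_gen (J `|` [set` take i f]) in
     forall x, K (f`_i * x) -> K x) <-> wregular J f by tauto.
elim: f J idJ => [|x f IH] J idJ //=.
have e0 : ideal_gen (J `|` [set` ([::] : seq A)]) = J.
  rewrite (_ : [set` [::]] = set0); last by apply/seteqP; split.
  by rewrite setU0 ideal_gen_id.
rewrite -IH; last exact: adjoin_is_ideal.
split=> [h|[h0 h] [|i] ilt u]; last 2 first.
- by rewrite /= e0; exact: h0.
- by rewrite /= (ideal_gen_cons _ _ idJ); exact: h.
split=> [u|i ilt K u]; first by have := h 0%N isT u; rewrite /= e0.
by have := h i.+1 ilt u; rewrite /= !(ideal_gen_cons _ _ idJ).
Qed.

(** A chain for J + (x) starts at a prime containing x, and [prime_below] supplies a prime over J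
    strictly below it. *)
Lemma wregular_height J P f : is_ideal J -> prime_ideal P -> J `<=` P ->
  [set` f] `<=` P -> wregular J f -> height_ge J P (size f).
Proof.
move=> idJ pP; elim: f J idJ => [|x f IH] J idJ JP fP /=.
  by exists (fun=> P); split.
case=> xJ reg.
have Px : P x by apply: fP; rewrite /= mem_head.
have idP : is_ideal P by case/prime_idealP: pP.
have [||||C [CP Cpr CS]] := IH (adjoin J x); [exact: adjoin_is_ideal|..|exact: reg|].
- exact: adjoin_min.
- by move=> y /= yf; apply: fP; rewrite /= inE yf orbT.
have [pC0 JC0] := Cpr 0%N isT.
have C0x : C 0%N x by apply: JC0; have := mem_adjoin x 1 idJ; rewrite mul1r.
have JC : J `<=` C 0%N by apply: subset_trans JC0; exact: sub_adjoin.
have [Q [pQ JQ QC nQx]] := prime_below idJ pC0 JC xJ.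
exists (fun i => if i is j.+1 then C j else Q); split=> //.
- move=> [|i] // ilt; have [pCi JCi] := Cpr i ilt; split=> //.
  by apply: subset_trans JCi; exact: sub_adjoin.
- move=> [|i] ilt; last exact: CS.
  by split=> // h; apply: nQx; exact: h.
Qed.

End Primes.

(** * Free resolutions and depth *)

Section FreeComplex.
Variables (A : comNzRingType) (B : nat -> finType).
Variable D : forall i, B i -> B i.+1 -> A.
Implicit Types (I J P : set A).

Definition bdry i (u : B i.+1 -> A) (G : B i) : A := \sum_F D G F * u F.

Definition exact_mod J i := forall u : B i.+1 -> A, (forall G, J (bdry u G)) ->
  exists w : B i.+2 -> A, forall F, J (u F - bdry w F).

Definition im_mod J i (u : B i -> A) :=
  exists w : B i.+1 -> A, forall G, J (u G - bdry w G).

Lemma bdry_lin i (a b : A) (u w : B i.+1 -> A) G :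
  bdry (fun F => a * u F + b * w F) G = a * bdry u G + b * bdry w G.
Proof.
rewrite /bdry !mulr_sumr -big_split; apply: eq_bigr => F _ /=; ring.
Qed.

Lemma bdry_mod J i (u w : B i.+1 -> A) : is_ideal J ->
  (forall F, J (u F - w F)) -> forall G, J (bdry u G - bdry w G).
Proof.
move=> idJ Juw G; rewrite /bdry -sumrB; apply: is_ideal_sum => // F _.
by rewrite -mulrBr; case: idJ => _ _; apply.
Qed.

Hypothesis bdry2 : forall i (u : B i.+2 -> A) G, bdry (bdry u) G = 0.

Lemma adjoin_fun J f i (u : B i -> A) : (forall G, adjoin J f (u G)) ->
  exists y : B i -> A, forall G, J (u G - y G * f).
Proof. by move=> h; have [y yP] := choice h; exists y. Qed.

(** A cycle u modulo J + (f) has boundary f y modulo J; regularity of f on the cokernel gives y =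
    bdry z, and u - f z is a cycle modulo J. *)
Lemma exact_mod_adjoin J f i : is_ideal J -> exact_mod J i ->
  (forall y : B i -> A, im_mod J (fun G => f * y G) -> im_mod J y) ->
  exact_mod (adjoin J f) i.
Proof.
move=> idJ ex reg u /adjoin_fun [y yP]; have [J0 JD JM] := idJ.
have [z zP] : im_mod J y.
  apply: reg; exists u => G; rewrite -opprB; apply: is_idealN => //.
  by rewrite mulrC.
have [w wP] : exists w : B i.+2 -> A, forall F, J (1 * u F + - f * z F - bdry w F).
  apply: (ex (fun F => 1 * u F + - f * z F)) => G; rewrite bdry_lin.
  have -> : 1 * bdry u G + - f * bdry z G =
     (bdry u G - y G * f) + f * (y G - bdry z G) by ring.
  by apply: JD => //; exact: JM.
exists w => F; exists (z F).
by have -> : u F - bdry w F - z F * f = 1 * u F + - f * z F - bdry w F by ring.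
Qed.

(** By exactness the cokernel in positive degree embeds in a free module over A/J, so an element
    regular on A/J is regular on it. *)
Lemma exact_mod_adjoinS J f i : is_ideal J -> nonzerodiv J f ->
  exact_mod J i -> exact_mod J i.+1 -> exact_mod (adjoin J f) i.+1.
Proof.
move=> idJ reg ex exS; apply: exact_mod_adjoin => // y [w wP].
have [J0 JD JM] := idJ; apply: ex => G; apply: reg.
have := bdry_mod idJ wP G; rewrite bdry2 subr0.
suff -> : bdry (fun F => f * y F) G = f * bdry y G by [].
by rewrite /bdry mulr_sumr; apply: eq_bigr => F _; ring.
Qed.

(* Reduce the resolution modulo the first element of f and shift it by one. *)
Lemma short_resolution_socle f J i (u : B i -> A) : is_ideal J ->
  wregular J f -> (forall j, (i <= j)%N -> exact_mod J j) ->
  (forall j, (i + size f <= j)%N -> B j -> False) ->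
  (forall a, a \in f -> im_mod J (fun G => a * u G)) -> im_mod J u.
Proof.
elim: f J i u => [|x f IH] J i u idJ /=.
  move=> _ _ B0 _; exists (fun=> 0) => G; case: (B0 i _ G).
  by rewrite addn0.
move=> [xJ reg] ex B0 fu; have [J0 JD JM] := idJ.
(* Modulo x the chain w is a cycle, and its class takes the place of u one degree higher: each a in
   f sends it to a boundary modulo J + (x). Once w = bdry z + x y modulo J, x can be cancelled from
   x (u - bdry y). *)
have [w wP] := fu x (mem_head _ _).
have [] := IH (adjoin J x) i.+1 w (adjoin_is_ideal x idJ) reg.
- by move=> [|j] // ij; apply: exact_mod_adjoinS => //; apply: ex => //; lia.
- by move=> j ij; apply: B0; lia.
- move=> a af; have [|w' w'P] := fu a; first by rewrite inE af orbT.
  have [|z zP] := ex i (leqnn i) (fun F => a * w F + - x * w' F).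
    move=> G; rewrite bdry_lin.
    have -> : a * bdry w G + - x * bdry w' G =
      x * (a * u G - bdry w' G) + - a * (x * u G - bdry w G) by ring.
    by apply: JD; apply: JM.
  exists z => F; exists (w' F).
  by have -> : a * w F - bdry z F - w' F * x = a * w F + - x * w' F - bdry z F by ring.
move=> z /adjoin_fun [y yP]; exists y => G; apply: xJ.
have h : J (bdry w G - x * bdry y G).
  have := @bdry_mod J i w (fun F => 1 * bdry z F + x * y F) idJ _ G.
  rewrite bdry_lin bdry2 mulr0 add0r; apply=> F.
  by have -> : w F - (1 * bdry z F + x * y F) = w F - bdry z F - y F * x by ring.
have -> : x * (u G - bdry y G) = (x * u G - bdry w G) + (bdry w G - x * bdry y G).
  by ring.
exact: JD.
Qed.

Definition ideal_plus I J : set A := [set x | exists2 a, I a & J (x - a)].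

Lemma ideal_plus_is_ideal I J : is_ideal I -> is_ideal J -> is_ideal (ideal_plus I J).
Proof.
move=> [I0 ID IM] [J0 JD JM]; split.
- by exists 0; rewrite ?subrr.
- move=> x y [a Ia Ja] [b Ib Jb]; exists (a + b); first exact: ID.
  by rewrite opprD addrACA; exact: JD.
- move=> a x [b Ib Jb]; exists (a * b); first exact: IM.
  by rewrite -mulrBr; exact: JM.
Qed.

Lemma ideal_plus_adjoin I J x : ideal_plus I (adjoin J x) = adjoin (ideal_plus I J) x.
Proof.
apply/seteqP; split=> y.
  by move=> [a Ia [b Jb]]; exists b, a => //; rewrite addrAC.
by move=> [b [a Ia Jb]]; exists a => //; exists b; rewrite addrAC.
Qed.

Lemma adjoinAC J x y : adjoin (adjoin J x) y = adjoin (adjoin J y) x.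
Proof.
by apply/seteqP; split=> z [a [b Jb]]; exists b, a; rewrite addrAC.
Qed.

(** Modulo J, from a u = b x the regularity of x modulo a gives b = c a, and then a (u - c x) = 0
    gives u = c x. *)
Lemma nonzerodiv_swap J a x : is_ideal J -> nonzerodiv J a ->
  nonzerodiv (adjoin J a) x -> nonzerodiv (adjoin J x) a.
Proof.
move=> idJ aJ xJ u [b Jb]; have [_ JD JM] := idJ.
have [c Jc] : adjoin J a b.
  apply: xJ; exists u; rewrite -opprB; apply: is_idealN => //.
  by rewrite mulrC (mulrC x).
exists c; apply: aJ.
have -> : a * (u - c * x) = (a * u - b * x) + x * (b - c * a) by ring.
by apply: JD => //; apply: JM.
Qed.

(** The element x is moved to the front by exchanging it with one entry after another; it takes the
    place of the last entry y. *)
Lemma wregular_swap J f x y : is_ideal J -> wregular J (rcons f y) ->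
  (forall i, (i <= size f)%N -> nonzerodiv (foldl (@adjoin A) J (take i f)) x) ->
  wregular (adjoin J x) f.
Proof.
elim: f J => [|a f IH] J idJ //= [aJ reg] xJ; split.
  apply: nonzerodiv_swap => //.
  by have := xJ 1%N isT; rewrite /= take0.
rewrite adjoinAC; apply: IH => //; first exact: adjoin_is_ideal.
by move=> i im; exact: (xJ i.+1).
Qed.

Lemma foldl_adjoin_is_ideal J f : is_ideal J -> is_ideal (foldl (@adjoin A) J f).
Proof. by elim: f J => //= a f IH J idJ; apply/IH/adjoin_is_ideal. Qed.

Lemma wregular_nth J f i : wregular J f -> (i < size f)%N ->
  nonzerodiv (foldl (@adjoin A) J (take i f)) f`_i.
Proof. by elim: f J i => // a f IH J [|i] /= [aJ reg] //; apply: IH. Qed.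

Variables (I P : set A) (b0 : B 0).
Hypotheses (nA : noetherian A) (idI : is_ideal I) (idP : is_ideal P).
Hypothesis B0 : forall b : B 0, b = b0.
Hypothesis imE : forall u : B 0 -> A,
  (exists w : B 1 -> A, forall G, bdry w G = u G) <-> I (u b0).

Lemma im_mod0P J (u : B 0 -> A) : im_mod J u <-> ideal_plus I J (u b0).
Proof.
split=> [[w wP]|[a Ia Ja]].
  by exists (bdry w b0) => //; apply/(imE (bdry w)); exists w.
have [w wP] := (imE (fun=> a)).2 Ia.
by exists w => G; rewrite (B0 G) wP.
Qed.

Lemma depth_of_resolution (c : nat) f J : is_ideal J -> [set` f] `<=` P ->
  wregular J f -> (forall i, exact_mod J i) -> (forall j, (c < j)%N -> B j -> False) ->
  (c <= size f)%N ->
  exists g, [/\ size g = (size f - c)%N, [set` g] `<=` P & wregular (ideal_plus I J) g].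
Proof.
move=> + + + + Bc; elim/last_ind: f J => [|f y IH] J idJ fP reg ex cf.
  by exists [::].
move: cf; rewrite leq_eqVlt => /orP[/eqP cf|cf].
  by exists [::]; rewrite cf subnn.
have idIJ := ideal_plus_is_ideal idI idJ.
(* One x has to be regular modulo every initial segment of f and on A/(I + J), which has index
   [(size f).+1]. For a segment, the next entry of the sequence lies in P and is regular; for I + J,
   [short_resolution_socle] applies. *)
pose K i := if (i <= size f)%N then foldl (@adjoin A) J (take i f) else ideal_plus I J.
have [i ilt|x [Px xK]] := avoid_zero_divisors (m := (size f).+2) (J := K) nA idP.
  rewrite /K; case: leqP => [lei|_]; split=> //.
  - exact: foldl_adjoin_is_ideal.
  - move=> u uP; have := @wregular_nth _ (rcons f y) i reg.
    rewrite size_rcons ltnS => /(_ lei u).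
    have -> : take i (rcons f y) = take i f by rewrite -cats1 takel_cat.
    apply; apply: uP; apply: fP => /=.
    by rewrite mem_nth// size_rcons ltnS.
  - move=> u uP; apply/(im_mod0P J (fun=> u)).
    apply: (@short_resolution_socle (rcons f y)) => //.
      by move=> j; rewrite add0n => jf; apply: Bc; exact: leq_trans cf jf.
    by move=> a af; apply/im_mod0P; apply: uP; exact: fP.
have xIJ : nonzerodiv (ideal_plus I J) x.
  by have := xK (size f).+1 (ltnSn _); rewrite /K ltnn.
have xi i : (i <= size f)%N -> nonzerodiv (foldl (@adjoin A) J (take i f)) x.
  by move=> ile; have := xK i; rewrite /K ile; apply; lia.
have xJ : nonzerodiv J x by have := xi 0%N isT; rewrite take0.
have [|||||g [gs gP greg]] := IH (adjoin J x).
- exact: adjoin_is_ideal.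
- by move=> z /= zf; apply: fP; rewrite /= mem_rcons inE zf orbT.
- exact: wregular_swap reg xi.
(* In the lowest degree the cokernel is A/(I + J), on which x was chosen regular. *)
- case=> [|i]; last exact: exact_mod_adjoinS.
  by apply: exact_mod_adjoin => // z /im_mod0P /xIJ h; apply/im_mod0P.
- by move: cf; rewrite size_rcons ltnS.
exists (x :: g); split.
- by move: cf; rewrite /= gs size_rcons => cf; rewrite subSn.
- by move=> z /=; rewrite inE => /orP[/eqP ->//|]; exact: gP.
- by rewrite /= -ideal_plus_adjoin.
Qed.

End FreeComplex.

(** * Dimension of polynomial rings *)

Lemma mpoly_subring (n : nat) (R : nzRingType) (P : {mpoly R[n]} -> Prop) :
  (forall c, P c%:MP) -> (forall i, P 'X_i) ->
  (forall p q, P p -> P q -> P (p + q)) -> (forall p q, P p -> P q -> P (p * q)) ->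
  forall p, P p.
Proof.
move=> PC PX PD PM; move=> p; elim/mpolyind: p => [|c m p _ _ Pp].
  by rewrite -(mpolyC0 n R); exact: PC.
apply: PD => //; rewrite -mul_mpolyC; apply: (PM); first exact: PC.
rewrite mpolyXE_id; elim/big_ind: _ => [||i _]; [|exact: PM|].
  by rewrite -(mpolyC1 n R); exact: PC.
elim: (m i) => [|e IH]; first by rewrite expr0 -(mpolyC1 n R); exact: PC.
by rewrite exprS; exact: PM.
Qed.

(* Rewriting with an equation on [f (muni p)] diverges, because [muni] is
   transparent; hence the [congr]s below. *)
Lemma muni_retract (R : comNzRingType) (n : nat) :
  exists f : {rmorphism {poly {mpoly R[n]}} -> {mpoly R[n.+1]}},
    forall p, f (muni p) = p.
Proof.
have [f [fC fX]] : exists f : {rmorphism {poly {mpoly R[n]}} -> {mpoly R[n.+1]}},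
    (forall p, f p%:P = mwiden p) /\ f 'X = 'X_ord_max.
  exists (horner_eval 'X_ord_max \o map_poly (@mwiden n R)); split=> [p|] /=.
    by rewrite map_polyC /horner_eval /= hornerC.
  by rewrite map_polyX /horner_eval hornerX.
exists f; elim/mpoly_subring => [c|i|p q IHp IHq|p q IHp IHq].
- by rewrite muniC fC mwidenC.
- rewrite /muni mmapX mmap1U; case: splitP => [j ij|j ij].
    rewrite fC mwidenX mnmwiden1; congr 'X_[U_(_)].
    exact/val_inj.
  rewrite fX; congr 'X_[U_(_)]; apply/val_inj.
  by move: ij => /= ->; rewrite ord1 addn0.
- by rewrite muniD rmorphD; congr (_ + _).
- by rewrite muniM rmorphM; congr (_ * _).
Qed.

Lemma noetherian_mpoly (R : comNzRingType) n : noetherian R -> noetherian {mpoly R[n]}.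
Proof.
move=> nR; elim: n => [|n IH].
  apply: (@noetherian_image _ _ (@mpolyC 0 R)) nR _ => p.
  exists p@_0%MM; apply/mpolyP => m; rewrite mcoeffC.
  have -> : m = 0%MM by apply/mnmP => -[].
  by rewrite eqxx mulr1.
have [f fK] := muni_retract R n.
apply: (noetherian_image (noetherian_poly IH)) => p.
by exists (muni p); exact: fK.
Qed.

Section Dimension.
Variables (k : fieldType) (r : nat).
Local Notation S := {mpoly k[r]}.

Lemma msize_leM (p q : S) a b :
  (msize p <= a.+1)%N -> (msize q <= b.+1)%N -> (msize (p * q) <= (a + b).+1)%N.
Proof.
have [->|p0] := eqVneq p 0; first by rewrite mul0r msize0.
have [->|q0] := eqVneq q 0; first by rewrite mulr0 msize0.
move=> pa qb; rewrite msizeM// -subn1 leq_subLR.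
by apply: leq_trans (leq_add pa qb) _; lia.
Qed.

Lemma msize_leX (p : S) a n : (msize p <= a.+1)%N -> (msize (p ^+ n) <= (n * a).+1)%N.
Proof.
move=> pa; elim: n => [|n IH]; first by rewrite expr0 msize1.
by rewrite exprS mulSn; exact: msize_leM.
Qed.

(* Counting: there are N^(r+1) monomials in the y_i with exponents below N,
   living in a space of dimension (E N)^r for a constant E. *)
Lemma mpoly_dependent (y : 'I_r.+1 -> S) :
  exists N (c : {ffun 'I_r.+1 -> 'I_N} -> k),
    (exists e, c e != 0) /\ \sum_e c e *: \prod_i y i ^+ e i = 0.
Proof.
(* The products have size at most M, so their monomials have exponents below M. There are M^r = N^r
   E^r of these, and N > E^r makes this less than N^(r+1). *)
pose d := (\max_i msize (y i))%N; pose E := (r.+1 * d).+1.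
pose N := (E ^ r).+1; pose M := (N * E)%N.
pose rT : finType := {ffun 'I_r.+1 -> 'I_N}; pose cT : finType := {ffun 'I_r -> 'I_M}.
pose prd (e : rT) := \prod_i y i ^+ e i.
pose mon (m : cT) : 'X_{1..r} := [multinom (m i : nat) | i < r].
pose X := \matrix_(a < #|rT|, b < #|cT|) (prd (enum_val a))@_(mon (enum_val b)).
have lt : (#|cT| < #|rT|)%N.
  by rewrite !card_ffun !card_ord expnMn expnS mulnC ltn_pmul2r ?expn_gt0//.
have /rowV0Pn [v /sub_kermxP vX v0] : kermx X != 0.
  rewrite -mxrank_eq0 mxrank_ker subn_eq0 -ltnNge.
  exact: leq_ltn_trans (rank_leq_col _) lt.
exists N, (fun e => v 0 (enum_rank e)); split.
  have /existsP [a va] : [exists a, v 0 a != 0].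
    rewrite -negb_forall; apply: contra v0 => /forallP h.
    by apply/eqP/rowP => a; rewrite mxE; exact/eqP.
  by exists (enum_val a); rewrite enum_valK.
have szprd e : (msize (prd e) <= M)%N.
  have : (msize (prd e) <= (\sum_(i < r.+1) N.-1 * d).+1)%N.
    rewrite /prd; apply: (big_rec2 (fun p a => msize p <= a.+1)%N).
      by rewrite msize1.
    move=> i a p _ pa; apply: msize_leM => //.
    have yi : (msize (y i) <= d.+1)%N.
      by apply: leqW; exact: (leq_bigmax i).
    apply: leq_trans (msize_leX _ yi) _; rewrite ltnS leq_mul2r.
    by rewrite -ltnS prednK// ltn_ord orbT.
  move=> /leq_trans; apply; rewrite sum_nat_const card_ord /M /E.
  by rewrite mulnS mulnCA; have : (N > 0)%N by []; nia.
apply/mpolyP => m; rewrite mcoeff0 raddf_sum /=.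
have [/forallP mM|/forallPn /= [j mj]] := boolP [forall i, (m i < M)%N]; last first.
  apply: big1 => e _; rewrite mcoeffZ; apply/eqP; rewrite mulf_eq0; apply/orP; right.
  rewrite -/(prd e) mcoeff_eq0; apply: msize_mdeg_ge.
  apply: leq_trans (szprd e) _; move: mj; rewrite -leqNgt => /leq_trans; apply.
  by rewrite mdegE (bigD1 j) //= leq_addr.
pose b : cT := [ffun i => Ordinal (mM i)].
have mE : m = mon b by apply/mnmP => i; rewrite mnmE ffunE.
have := congr1 (fun w : 'rV_ _ => w 0 (enum_rank b)) vX; rewrite !mxE => {2}<-.
rewrite (reindex (@enum_val rT rT)) /=; last first.
  by exists enum_rank => e _; rewrite ?enum_valK ?enum_rankK.
by apply: eq_bigr => a _; rewrite mcoeffZ mxE enum_valK enum_rankK mE.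
Qed.

(* Along a chain of primes C_0 < C_1 < ..., choose y_i in C_(i+1) but not in
   C_i; the lexicographically smallest monomial of a relation between the y_i
   would have a coefficient in the last prime. *)
Lemma height_le_nvars (J P : set S) h : height_ge J P h -> (h <= r)%N.
Proof.
move=> [C [_ Cp CS]]; rewrite leqNgt; apply/negP => rh.
have /choice [y yP] : forall i : 'I_r.+1, exists y, C i.+1 y /\ ~ C i y.
  move=> i; have [_ nC] := CS i (leq_trans (ltn_ord i) rh).
  apply: contrapT => ny; apply: nC => x Cx; apply: contrapT => nx.
  by apply: ny; exists x.
have [N [c [[e0 ce0] yc]]] := mpoly_dependent y.
have pC i : (i <= r.+1)%N -> prime_ideal (C i).
  by move=> ir; apply: (Cp i (leq_trans ir rh)).1.
have idC i : (i <= r.+1)%N -> is_ideal (C i) by move=> /pC /prime_idealP [].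
pose T : finType := {ffun 'I_r.+1 -> 'I_N}.
(* E holds the exponent vectors with nonzero coefficient that share the lexicographically least
   first n entries. To pass to n + 1, the least power of y_n is cancelled using the prime C_n, and
   the terms with a larger exponent are dropped because y_n lies in C_(n+1). At n = r + 1 a single
   nonzero constant is left. *)
have : forall n, (n <= r.+1)%N -> exists E : {set T}, [/\ exists e, e \in E,
    forall e, e \in E -> c e != 0,
    forall e e', e \in E -> e' \in E -> forall i : 'I_r.+1, (i < n)%N -> e i = e' i
  & C n (\sum_(e in E) c e *: \prod_(i : 'I_r.+1 | (n <= i)%N) y i ^+ e i)].
  elim=> [|n IH] nr.
    exists [set e | c e != 0]%SET; split => //.
    - by exists e0; rewrite inE.
    - by move=> e; rewrite inE.
    have : C 0%N (\sum_e c e *: \prod_i y i ^+ e i).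
      by rewrite yc; case: (idC 0%N isT).
    rewrite (bigID (fun e => c e != 0)) /=.
    rewrite [X in _ + X]big1 ?addr0; last first.
      by move=> e /negPn /eqP ->; rewrite scale0r.
    by congr (C _ _); apply: eq_big => [e|e _]; rewrite ?inE.
  have [E [[e1 e1E] cE eqE CE]] := IH (ltnW nr).
  pose j := Ordinal nr; case: (arg_minnP (fun e : T => e j : nat) e1E) => e2 /= e2E min2.
  have {}e2E : e2 \in E := e2E.
  exists [set e in E | e j == e2 j]%SET; split.
  - by exists e2; rewrite inE e2E eqxx.
  - by move=> e; rewrite inE => /andP[/cE].
  - move=> e e'; rewrite !inE => /andP[eE /eqP ej] /andP[eE' /eqP ej'] i.
    rewrite ltnS leq_eqVlt => /orP[/eqP ij|]; last exact: eqE.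
    by rewrite (_ : i = j) ?ej ?ej'//; exact/val_inj.
  have [Cy nCy] := yP j.
  have [_ CD CM] := idC n.+1 nr.
  pose F (e : T) := \prod_(i : 'I_r.+1 | (n.+1 <= i)%N) y i ^+ e i.
  have FE (e : T) : \prod_(i : 'I_r.+1 | (n <= i)%N) y i ^+ e i = y j ^+ e j * F e.
    rewrite (bigD1 j) //=; congr (_ * _); apply: eq_bigl => i.
    by rewrite ltn_neqAle andbC eq_sym.
  have Cn : C n.+1 (\sum_(e in E) c e *: (y j ^+ (e j - e2 j) * F e)).
    have [sub _] := CS n (leq_trans nr rh); apply: sub.
    have /prime_idealP [_ _ pr] := pC n (ltnW nr).
    have : C n (y j ^+ e2 j * \sum_(e in E) c e *: (y j ^+ (e j - e2 j) * F e)).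
      rewrite mulr_sumr; move: CE; congr (C n _); apply: eq_bigr => e eE.
      by rewrite FE -scalerAr mulrA -exprD subnKC// min2.
    by move=> /pr [/(prime_ideal_exp (pC n (ltnW nr)))|].
  move: Cn; rewrite (bigID (fun e : T => e j == e2 j)) /= => Cn.
  have : C n.+1 (\sum_(e in E | e j != e2 j) c e *: (y j ^+ (e j - e2 j) * F e)).
    apply: is_ideal_sum => [|e /andP[eE ne]]; first exact: idC.
    rewrite -mul_mpolyC; apply: (CM).
    have lt : (0 < e j - e2 j)%N.
      by rewrite subn_gt0 ltn_neqAle eq_sym ne min2.
    by rewrite -(prednK lt) exprS -mulrA mulrC; apply: CM.
  move=> /(is_idealB (idC _ nr) Cn); rewrite addrK; congr (C _ _).
  apply: eq_big => [e|e /andP[_ /eqP ->]]; first by rewrite inE.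
  by rewrite subnn expr0 mul1r.
move=> /(_ r.+1 (leqnn _)) [E [[e eE] cE eqE]].
have -> : E = [set e]%SET.
  apply/setP => e'; rewrite inE; apply/idP/eqP => [eE'|-> //].
  by apply/ffunP => i; apply: eqE.
rewrite big_set1 big_pred0 => [|i]; last by rewrite leqNgt ltn_ord.
move=> Cc; have /prime_idealP [[_ _ CM] C1 _] := pC _ (leqnn _).
apply: C1; have := CM ((c e)^-1)%:MP _ Cc.
by rewrite mul_mpolyC scalerA mulVf ?scale1r//; exact: cE.
Qed.

End Dimension.

(** * The Nullstellensatz *)

Lemma quotient_ring (A : comNzRingType) (P : set A) : idealr_closed (mem P) ->
  exists (L : comNzRingType) (f : {rmorphism A -> L}),
    (forall y, exists x, f x = y) /\ forall x, f x = 0 <-> P x.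
Proof.
move=> idP.
pose S : A -> bool := fun x => x \in P.
have idS : idealr_closed S by [].
pose I : idealr A := HB.pack S (isIdealr.Build A S idS).
exists (Quotient.quot I), (\pi_(Quotient.quot I))%qT; split=> [y|x].
  by exists (repr (y : Quotient.quot I)); exact: reprK.
have -> : P x <-> (x - 0 \in (I : {pred A})).
  by rewrite subr0; split; [exact: mem_set|exact: set_mem].
have pi0 : (\pi_(Quotient.quot I))%qT 0 = 0 by exact: rmorph0.
rewrite Quotient.idealrBE; split=> [e|/eqP e]; last exact: etrans e pi0.
by apply/eqP; exact: etrans e (esym pi0).
Qed.

(** Multiplying the relation p(a) = 0 of degree n + 1 by s^n makes it monic in s a. A constant p
    forces phi s = 0. *)
Lemma integral_lead_coef (R K : comNzRingType) (phi : {rmorphism R -> K})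
    (p : {poly R}) (a : K) : (map_poly phi p).[a] = 0 ->
  integralOver phi (phi (lead_coef p) * a).
Proof.
set s := lead_coef p; move=> pa0.
have [sz|sz] := leqP (size p) 1.
  move: pa0; rewrite (size1_polyC sz) map_polyC hornerC => p0.
  suff -> : phi s = 0 by rewrite mul0r; exact: integral0.
  by rewrite /s (size1_polyC sz) lead_coefC.
pose n := (size p).-2; have szn : size p = n.+2 by rewrite /n; lia.
pose q := \poly_(i < n.+2) (if i == n.+1 then 1 else p`_i * s ^+ (n - i)).
have qn : q`_n.+1 = 1 by rewrite coef_poly ltnSn eqxx.
have szq : size q = n.+2.
  by rewrite size_poly_eq// eqxx oner_eq0.
exists q; first by rewrite monicE lead_coefE szq /= qn.
rewrite /root (@horner_coef_wide _ n.+2); last by rewrite (leq_trans (size_poly _ _))// szq.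
have cE w i : (map_poly phi w)`_i = phi w`_i by exact: coef_map.
have -> : \sum_(i < n.+2) (map_poly phi q)`_i * (phi s * a) ^+ i =
    phi s ^+ n * \sum_(i < n.+2) (map_poly phi p)`_i * a ^+ i.
  rewrite mulr_sumr; apply: eq_bigr => i _; rewrite !cE coef_poly ltn_ord.
  rewrite exprMn; case: eqP => [->|/eqP ne].
    have -> : phi p`_n.+1 = phi s by rewrite /s lead_coefE szn.
    rewrite (rmorph1 phi) exprSr; ring.
  have le : (i <= n)%N by have := ltn_ord i; rewrite ltnS leq_eqVlt (negbTE ne).
  rewrite (rmorphM phi) (rmorphXn phi) /=.
  have -> : phi s ^+ n = phi s ^+ (n - i) * phi s ^+ i by rewrite -exprD subnK.
  ring.
rewrite -horner_coef_wide ?pa0 ?mulr0//.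
by rewrite -szn; exact: size_poly.
Qed.

Section Nullstellensatz.
Variables (k : fieldType) (r : nat) (L : comNzRingType).
Variable f : {rmorphism {mpoly k[r]} -> L}.
Hypothesis f_surj : forall y, exists x, f x = y.
Hypothesis L_field : forall y : L, y != 0 -> exists z, z * y = 1.

Let c : {rmorphism k -> L} := f \o @mpolyC r k.

Definition alg_indep m (t : 'I_m -> L) :=
  forall Q : {mpoly k[m]}, mmap c t Q = 0 -> Q = 0.

Lemma alg_indep0 (t : 'I_0 -> L) : alg_indep t.
Proof.
move=> Q; have -> : Q = (Q@_0%MM)%:MP.
  apply/mpolyP => m; have -> : m = 0%MM by apply/mnmP => -[].
  by rewrite mcoeffC eqxx mulr1.
by rewrite mmapC => /eqP; rewrite fmorph_eq0 => /eqP ->; rewrite mpolyC0.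
Qed.

(** Lifts of the t_i to the polynomial ring satisfy the relation of [mpoly_dependent], and f carries
    it to L. *)
Lemma alg_indep_nvars (t : 'I_r.+1 -> L) : ~ alg_indep t.
Proof.
have [y yP] := choice (fun i => f_surj (t i)).
have [N [a [[e0 a0] ya]]] := mpoly_dependent y.
pose mon (e : {ffun 'I_r.+1 -> 'I_N}) : 'X_{1..r.+1} := [multinom (e i : nat) | i < r.+1].
pose Q : {mpoly k[r.+1]} := \sum_e a e *: 'X_[mon e].
move=> it; have : Q = 0.
  apply: it; have <- : f 0 = 0 by exact: rmorph0.
  rewrite -[X in f X]ya rmorph_sum /Q raddf_sum; apply: eq_bigr => e _.
  rewrite /= mmapZ mmapX -mul_mpolyC rmorphM rmorph_prod; congr (_ * _).
  by apply: eq_bigr => i _; rewrite rmorphXn /= yP mnmE.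
move=> /(congr1 (mcoeff (mon e0))) /eqP.
rewrite mcoeff0 raddf_sum (bigD1 e0) //= big1 => [|e ne].
  by rewrite addr0 mcoeffZ mcoeffX eqxx mulr1 (negbTE a0).
rewrite mcoeffZ mcoeffX; case: eqP => [|_]; rewrite ?mulr0// => /mnmP h.
case/eqP: ne; apply/ffunP => i; apply/val_inj.
by have := h i; rewrite !mnmE.
Qed.

Lemma horner_muni m (t : 'I_m.+1 -> L) (Q : {mpoly k[m.+1]}) :
  (map_poly (mmap c (fun i => t (lift ord_max i))) (muni Q)).[t ord_max] = mmap c t Q.
Proof.
set phi := mmap c _.
elim/mpoly_subring: Q => [a|i|p q IHp IHq|p q IHp IHq].
- by rewrite muniC map_polyC hornerC /= /phi !mmapC.
- rewrite [in RHS]mmapX /muni mmapX !mmap1U; case: splitP => [j ij|j ij].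
    rewrite map_polyC hornerC /= /phi mmapX mmap1U; congr (t _).
    by apply/val_inj => /=; rewrite /bump leqNgt ltn_ord.
  rewrite map_polyX hornerX; congr (t _); apply/val_inj.
  by move: ij => /= ->; rewrite ord1 addn0.
- by rewrite muniD !rmorphD hornerD; congr (_ + _).
- by rewrite muniM !rmorphM hornerM; congr (_ * _).
Qed.

Lemma alg_dependent m (t : 'I_m -> L) a :
  (forall t' : 'I_m.+1 -> L, ~ alg_indep t') ->
  exists p : {poly {mpoly k[m]}}, p != 0 /\ (map_poly (mmap c t) p).[a] = 0.
Proof.
pose t' (i : 'I_m.+1) := oapp t a (unlift ord_max i).
move=> /(_ t') /existsNP [Q /not_implyP [Qt Q0]]; exists (muni Q); split.
  have [g gK] := muni_retract k m; apply/negP => /eqP Q0'.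
  by apply: Q0; rewrite -(gK Q) Q0' rmorph0.
rewrite -Qt -horner_muni /t' unlift_none; congr (map_poly (mmap c _) _).[_].
by apply/funext => i; rewrite liftK.
Qed.

Lemma exists_alg_basis : exists m (t : 'I_m -> L), alg_indep t /\
  forall t' : 'I_m.+1 -> L, ~ alg_indep t'.
Proof.
apply: contrapT => nm.
suff h m : exists t : 'I_m -> L, alg_indep t.
  by have [t /alg_indep_nvars] := h r.+1.
elim: m => [|m [t it]]; first by exists (fun=> 0); exact: alg_indep0.
apply: contrapT => nt; apply: nm; exists m, t; split=> // t' it'.
by apply: nt; exists t'.
Qed.

Lemma mpoly_unit_Xs m (s v : {mpoly k[m.+1]}) : s != 0 ->
  (1 + 'X_ord0 * s) * v = 1 -> False.
Proof.
set q := 1 + _ => s0 qv.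
have q0 : q != 0 by apply/negP => /eqP q0; move/eqP: qv; rewrite q0 mul0r eq_sym oner_eq0.
have v0 : v != 0 by apply/negP => /eqP v0; move/eqP: qv; rewrite v0 mulr0 eq_sym oner_eq0.
have q1 : (msize q <= 1)%N.
  have := msizeM q0 v0; rewrite qv msize1.
  have : (0 < msize q)%N by rewrite lt0n msize_poly_eq0.
  have : (0 < msize v)%N by rewrite lt0n msize_poly_eq0.
  move: (msize q) (msize v) => a b; lia.
have /eqP := msize1_polyC q1; rewrite /q addrC -subr_eq0 -addrA.
have X0 : 'X_ord0 != 0 :> {mpoly k[m.+1]} by rewrite -msize_poly_eq0 msizeX.
rewrite addr_eq0 -mpolyC1 -rmorphB -rmorphN => /eqP e.
have : (msize ('X_ord0 * s) <= 1)%N by rewrite e msizeC leq_b1.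
rewrite msizeM// msizeX mdeg1.
have : (0 < msize s)%N by rewrite lt0n msize_poly_eq0.
move: (msize s) => a; lia.
Qed.

(* Otherwise L would be integral over a localization k[t][1/s], and inverting
   q = 1 + t_0 s would make q divide a power of s, hence a unit. *)
Lemma alg_basis_empty m (t : 'I_m -> L) : alg_indep t ->
  (forall t' : 'I_m.+1 -> L, ~ alg_indep t') -> m = 0%N.
Proof.
case: m t => // m t it nt.
pose phi : {rmorphism {mpoly k[m.+1]} -> L} := mmap c t.
have phi0 Q : phi Q = 0 -> Q = 0 by exact: it.
have [p pP] := choice (fun j : 'I_r => alg_dependent t (f 'X_j) nt).
(* s clears all denominators: its image times any f(x_j) is integral over k[t]. *)
pose s := \prod_j lead_coef (p j).
have s0 : s != 0 by apply/prodf_neq0 => j _; rewrite lead_coef_eq0; case: (pP j).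
have int (h : L) : exists N, integralOver phi (phi s ^+ N * h).
  have [x <-] := f_surj h; elim/mpoly_subring: x => [a|j|x y|x y].
  - exists 0%N; rewrite expr0 mul1r.
    have -> : f a%:MP = phi a%:MP by rewrite /phi /= mmapC.
    exact: integral_id.
  - exists 1%N; rewrite expr1 /s (bigD1 j) //= rmorphM [X in X * _]mulrC -mulrA.
    apply: integral_mul; first exact: integral_id.
    by apply: integral_lead_coef; case: (pP j).
  - move=> [N xN] [M yM]; exists (N + M)%N; rewrite rmorphD mulrDr.
    apply: integral_add; rewrite exprD.
      by rewrite mulrAC mulrC; apply: integral_mul => //; rewrite -rmorphXn; exact: integral_id.
    by rewrite -mulrA; apply: integral_mul => //; rewrite -rmorphXn; exact: integral_id.
  - move=> [N xN] [M yM]; exists (N + M)%N; rewrite rmorphM exprD mulrACA.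
    exact: integral_mul.
pose q := 1 + 'X_ord0 * s.
have q0 : q != 0.
  apply/negP => /eqP /(congr1 (mcoeff 0%MM)) /eqP.
  rewrite mcoeff0 mcoeffD mcoeff1 eqxx rmorphM /= mcoeffX.
  by rewrite mnm1_eq0 mul0r addr0 oner_eq0.
have [|h hq] := L_field (y := phi q).
  by apply: contra q0 => /eqP /phi0 ->.
have [N [u um /rootP uh]] := int h.
pose n := (size u).-1.
have szu : size u = n.+1 by rewrite prednK// size_poly_gt0 monic_neq0.
have un : u`_n = 1 by apply/eqP; rewrite -lead_coefE -monicE.
(* The integral equation of s^N h, multiplied by q^n: as q h = 1 in L, it becomes an identity of
   polynomials. *)
have Ds : \sum_(i < n.+1) u`_i * s ^+ (N * i) * q ^+ (n - i) = 0.
  have cE i : (map_poly phi u)`_i = phi u`_i by exact: coef_map.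
  have uhq : phi q ^+ n * (map_poly phi u).[phi s ^+ N * h] = 0 by rewrite uh mulr0.
  apply: phi0; apply: etrans uhq; rewrite (rmorph_sum phi).
  rewrite (@horner_coef_wide _ n.+1); last by rewrite -szu; exact: size_poly.
  rewrite mulr_sumr; apply: eq_bigr => i _; rewrite cE.
  have le : (i <= n)%N by rewrite -ltnS ltn_ord.
  rewrite !(rmorphM phi) !(rmorphXn phi) exprMn -exprM.
  have -> : phi q ^+ n = phi q ^+ (n - i) * phi q ^+ i by rewrite -exprD subnK.
  have hq' : phi q ^+ i * h ^+ i = 1 by rewrite -exprMn mulrC hq expr1n.
  rewrite -[LHS]mulr1 -hq'; ring.
have [v sv] : exists v, s ^+ (N * n) = q * v.
  exists (- \sum_(i < n) u`_i * s ^+ (N * i) * q ^+ (n - i).-1).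
  move/eqP: Ds; rewrite big_ord_recr /= subnn expr0 mulr1 un mul1r addrC addr_eq0.
  move=> /eqP ->; rewrite mulrN; congr (- _); rewrite mulr_sumr.
  apply: eq_bigr => i _; have lt : (0 < n - i)%N by rewrite subn_gt0.
  by rewrite -{1}(prednK lt) exprS mulrCA.
(* Modulo q the product x_0 s is -1, so if q divides a power of s it divides a power of -1. *)
have [w wq] : exists w, (-1) ^+ (N * n) = q * w.
  set M := (N * n)%N in sv *.
  have /eqP : (q - 1) ^+ M = q * ('X_ord0 ^+ M * v).
    by rewrite /q addrC addKr exprMn -/q sv mulrCA.
  have := subrXX (q - 1) (-1) M; rewrite opprK subrK => /eqP.
  rewrite subr_eq => /eqP -> /eqP.
  set z := \sum_(i < _) _ => e; exists ('X_ord0 ^+ M * v - z).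
  by rewrite mulrBr -e addrAC subrr add0r.
case: (@mpoly_unit_Xs m s (w * (-1) ^+ (N * n))) => //.
by rewrite mulrA -wq -expr2 sqrr_sign.
Qed.

Lemma nullstellensatz j : exists p : {poly k},
  p != 0 /\ (map_poly c p).[f 'X_j] = 0.
Proof.
have [m [t [it nt]]] := exists_alg_basis.
have m0 := alg_basis_empty it nt; subst m.
have [p [p0 pj]] := alg_dependent t (f 'X_j) nt.
have C0 (Q : {mpoly k[0]}) : Q = (Q@_0%MM)%:MP.
  apply/mpolyP => m; have -> : m = 0%MM by apply/mnmP => -[].
  by rewrite mcoeffC eqxx mulr1.
exists (map_poly (mcoeff 0%MM) p); split.
  rewrite map_poly_eq0_id0 ?lead_coef_eq0//.
  apply/negP => /eqP h; move: p0; rewrite -lead_coef_eq0 (C0 (lead_coef p)) h.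
  by rewrite mpolyC0 eqxx.
rewrite -pj; congr (_.[_]); apply/polyP => i; rewrite coef_map coef_map_id0; last exact: mcoeff0.
rewrite coef_map_id0; last exact: rmorph0.
by rewrite [in RHS](C0 p`_i) mmapC.
Qed.

End Nullstellensatz.

(** * Regular sequences of univariate polynomials in a maximal ideal *)

Section UnivariateSequence.
Variables (k : fieldType) (r : nat).
Local Notation S := {mpoly k[r]}.

Definition univ (j : 'I_r) (p : {poly k}) : S := (map_poly (@mpolyC r k) p).['X_j].

Lemma maximal_ideal_univ (P : set S) (j : 'I_r) : maximal_ideal P ->
  exists p : {poly k}, p != 0 /\ P (univ j p).
Proof.
move=> mP; have [iP Pmax] := mP; have [idP P1] := (idealr_closedP P).1 iP.
have [L [f [f_surj fP]]] := quotient_ring iP.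
have [|p [p0 pj]] := nullstellensatz (f := f) f_surj _ j.
  move=> y y0; have [x xy] := f_surj y; apply: contrapT => nz.
  have nPx : ~ P x by move=> /fP; rewrite xy => /eqP; rewrite (negbTE y0).
  apply: nPx; rewrite -(Pmax (adjoin P x)).
  - by have := mem_adjoin x 1 idP; rewrite mul1r.
  - apply/idealr_closedP; split; first exact: adjoin_is_ideal.
    move=> [a /fP]; rewrite rmorphB rmorph1 rmorphM xy => /eqP; rewrite subr_eq0 => /eqP e.
    by apply: nz; exists (f a).
  - exact: sub_adjoin.
exists p; split=> //; apply/fP; rewrite -pj /univ -horner_map -map_poly_comp.
by [].
Qed.

(** Separates the variable x_j: the coefficients of the result are free of x_j, but stay in S so
    that no variables are renumbered. *)
Lemma sep_exists (j : 'I_r) : exists sep : {rmorphism S -> {poly S}},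
  (forall a, sep a%:MP = a%:MP%:P) /\
  (forall i, sep 'X_i = if i == j then 'X else ('X_i)%:P).
Proof.
exists (mmap (polyC \o @mpolyC r k) (fun i => if i == j then 'X else ('X_i)%:P)).
by split=> [a|i] /=; [rewrite mmapC|rewrite mmapX mmap1U].
Qed.

Section Separation.
Variables (j : 'I_r) (sep : {rmorphism S -> {poly S}}).
Hypotheses (sepC : forall a, sep a%:MP = a%:MP%:P)
  (sepX : forall i, sep 'X_i = if i == j then 'X else ('X_i)%:P).

Lemma sepK u : (sep u).['X_j] = u.
Proof.
elim/mpoly_subring: u => [a|i|p q IHp IHq|p q IHp IHq].
- by rewrite sepC hornerC.
- by rewrite sepX; case: eqP => [->|_]; rewrite ?hornerX ?hornerC.
- by rewrite rmorphD hornerD IHp IHq.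
- by rewrite rmorphM hornerM IHp IHq.
Qed.

Lemma sep_univ i p :
  sep (univ i p) = if i == j then map_poly (@mpolyC r k) p else (univ i p)%:P.
Proof.
rewrite /univ; elim/poly_ind: p => [|p a IH].
  by rewrite !rmorph0 horner0 rmorph0 if_same.
rewrite !rmorphD !rmorphM /= map_polyX map_polyC !hornerE !rmorphD !rmorphM IH.
rewrite sepX sepC /=; by case: eqP.
Qed.

(** Generators free of x_j become constants, so membership can be tested coefficient by
    coefficient. *)
Lemma sep_ideal (G : set S) u : (forall g, G g -> sep g = g%:P) ->
  ideal_gen G u <-> forall i, ideal_gen G (sep u)`_i.
Proof.
move=> Gj; have idG := ideal_gen_is_ideal G; have [_ _ GM] := idG; split=> h.
  move: h => [s [sG ->]] i; rewrite rmorph_sum coef_sum big_seq.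
  apply: is_ideal_sum => // t ts; rewrite rmorphM (Gj _ (sG _ ts)) coefMC.
  by apply: GM; apply: sub_ideal_gen; exact: sG.
rewrite -(sepK u) horner_coef; apply: is_ideal_sum => // i _.
by rewrite mulrC; apply: GM.
Qed.

End Separation.

(** The leading coefficient of p is a unit, so the coefficients of w enter K one after another, from
    the top one down. *)
Lemma coef_ideal_scale (K : set S) (p : {poly k}) (w : {poly S}) :
  is_ideal K -> p != 0 ->
  (forall i, K (map_poly (@mpolyC r k) p * w)`_i) -> forall i, K w`_i.
Proof.
move=> idK p0 Kpw; have [K0 KD KM] := idK.
suff h d i : (size w <= i + d)%N -> K w`_i by move=> i; apply: (h (size w)); lia.
elim: d i => [|d IH] i; first by rewrite addn0 => /(nth_default 0) ->.
move=> wi; pose n := (size p).-1.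
have : K (map_poly (@mpolyC r k) p * w)`_(n + i) by [].
rewrite coefM.
have lt : (n < (n + i).+1)%N by rewrite ltnS leq_addr.
rewrite (bigD1 (Ordinal lt)) //= coef_map addKn => h.
have Kl : K ((lead_coef p)%:MP * w`_i).
  rewrite -[X in K X](addrK (\sum_(a < (n + i).+1 | a != Ordinal lt)
    (map_poly (@mpolyC r k) p)`_a * w`_(n + i - a))).
  apply: is_idealB => //; apply: is_ideal_sum => // a ane.
  have [an|na] := ltnP a n; first by apply: KM; apply: IH; lia.
  rewrite coef_map nth_default ?rmorph0 ?mul0r //.
  have : (a : nat) != n by apply: contra ane => /eqP an; apply/eqP/val_inj.
  move=> an; have {an na} : (n < a)%N by rewrite ltn_neqAle eq_sym an na.
  by rewrite /n; move: (nat_of_ord a) => b; case: (size p).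
have := KM ((lead_coef p)^-1)%:MP _ Kl.
by rewrite mulrA -rmorphM mulVf ?lead_coef_eq0// rmorph1 mul1r.
Qed.

Lemma univ_nonzerodiv (G : set S) (j : 'I_r) (p : {poly k}) : p != 0 ->
  (forall g, G g -> exists i q, i != j /\ g = univ i q) ->
  nonzerodiv (ideal_gen G) (univ j p).
Proof.
move=> p0 Gj u; have [sep [sepC sepX]] := sep_exists j.
have Gsep g : G g -> sep g = g%:P.
  by move=> /Gj [i [q [/negbTE ij ->]]]; rewrite (sep_univ sepC sepX) ij.
move=> /(sep_ideal sepC sepX _ Gsep) Gpu; apply/(sep_ideal sepC sepX _ Gsep).
apply: (coef_ideal_scale (ideal_gen_is_ideal G) p0) => i.
by have := Gpu i; rewrite rmorphM (sep_univ sepC sepX) eqxx.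
Qed.

(** D collects the indices already used, so that the base ideal can grow during the induction on
    js. *)
Lemma univ_wregular (p : 'I_r -> {poly k}) (js : seq 'I_r) (D : set 'I_r) :
  (forall j, p j != 0) -> uniq js -> (forall j, j \in js -> ~ D j) ->
  wregular (ideal_gen ((fun j => univ j (p j)) @` D)) [seq univ j (p j) | j <- js].
Proof.
move=> p0; elim: js D => [//|j js IH] D /= /andP[njs us] Djs; split.
  apply: univ_nonzerodiv => // _ [i Di <-]; exists i, (p i); split=> //.
  by apply/negP => /eqP ij; apply: (Djs j); rewrite ?mem_head// -ij.
rewrite -ideal_gen_set1; last exact: ideal_gen_is_ideal.
rewrite ideal_genUl -(image_set1 (fun j => univ j (p j))) -image_setU.
apply: IH => // i ijs [Di|ij]; first by apply: (Djs i) => //; rewrite inE ijs orbT.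
by move: njs; rewrite -ij ijs.
Qed.

Lemma maximal_wregular (P : set S) : maximal_ideal P ->
  exists f, [/\ size f = r, [set` f] `<=` P & wregular [set 0] f].
Proof.
move=> mP; have [p pP] := choice (fun j => maximal_ideal_univ j mP).
exists [seq univ j (p j) | j <- enum 'I_r]; split.
- by rewrite size_map size_enum_ord.
- by move=> _ /= /mapP [j _ ->]; case: (pP j).
have := @univ_wregular p (enum 'I_r) set0; rewrite image_set0 ideal_gen_set0.
by apply; [move=> j; case: (pP j)|exact: enum_uniq|by move=> j _ []].
Qed.

End UnivariateSequence.

(** * Codimension of monomial ideals *)

Section Heights.
Variable A : comNzRingType.
Implicit Types J P Q : set A.

Lemma height_ge_le J P h h' : (h' <= h)%N -> height_ge J P h -> height_ge J P h'.
Proof.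
move=> le [C [CP Cp CS]]; exists (fun i => C (i + (h - h'))%N); split.
- by rewrite subnKC.
- by move=> i ih; apply: Cp; lia.
- by move=> i ih; rewrite addSn; apply: CS; lia.
Qed.

Lemma height_ge_cat J J' P h h' (C : nat -> set A) : height_ge J (C 0%N) h ->
  C h' = P -> (forall i, (i <= h')%N -> prime_ideal (C i) /\ J' `<=` C i) ->
  (forall i, (i < h')%N -> C i `<` C i.+1) -> height_ge J P (h + h').
Proof.
move=> [C1 [C1h C1p C1S]] CP Cp CS.
have JC i : (i <= h')%N -> J `<=` C i.
  elim: i => [|i IH] ih; first by rewrite -C1h; case: (C1p h (leqnn h)).
  by apply: subset_trans (IH (ltnW ih)) _; case: (CS i ih).
exists (fun i => if (i <= h)%N then C1 i else C (i - h)%N); split.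
- case: leqP => [le|_]; last by rewrite addKn.
  have h0 : h' = 0%N by lia.
  by rewrite h0 addn0 C1h -h0.
- move=> i ih; case: leqP => hi; first exact: C1p.
  have le : (i - h <= h')%N by lia.
  by split; [case: (Cp _ le)|exact: JC].
- move=> i ih; case: (ltngtP i h) => hi.
  + exact: C1S.
  + by rewrite subSn; [apply: CS; lia|exact: ltnW].
  + by rewrite hi C1h subSnn; apply: CS; lia.
Qed.

End Heights.

Section VariableIdeals.
Variables (k : fieldType) (r : nat).
Local Notation S := {mpoly k[r]}.
Implicit Types (T : {set 'I_r}) (P Q : set S).

Definition var_ideal T : set S := ideal_gen [set 'X_i | i in [set` T]].

Lemma var_ideal_is_ideal T : is_ideal (var_ideal T).
Proof. exact: ideal_gen_is_ideal. Qed.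

Lemma var_idealX T i : i \in T -> var_ideal T 'X_i.
Proof. by move=> iT; apply: sub_ideal_gen; exists i. Qed.

Lemma var_ideal_min T Q : is_ideal Q -> (forall i, i \in T -> Q 'X_i) -> var_ideal T `<=` Q.
Proof. by move=> idQ TQ; apply: ideal_gen_min => // _ [i /= iT <-]; exact: TQ. Qed.

(** The ideal is the kernel of a map into a domain, which gives its primality and decides which
    variables it contains. *)
Lemma var_ideal_ker T : exists f : {rmorphism S -> S},
  (forall u, var_ideal T u <-> f u = 0) /\
  forall i, f 'X_i = if i \in T then 0 else 'X_i.
Proof.
have [f [fC fX]] : exists f : {rmorphism S -> S}, (forall a, f a%:MP = a%:MP) /\
    forall i, f 'X_i = if i \in T then 0 else 'X_i.
  exists (mmap (@mpolyC r k) (fun i => if i \in T then 0 else 'X_i)).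
  by split=> [a|i] /=; [rewrite mmapC|rewrite mmapX mmap1U].
exists f; split=> // u; have idT := var_ideal_is_ideal T.
split=> [[s [sT ->]]|fu].
  rewrite rmorph_sum big_seq big1 // => t /sT [i iT e].
  by rewrite rmorphM -e fX /= iT mulr0.
suff h v : var_ideal T (v - f v) by have := h u; rewrite fu subr0.
have [_ TD TM] := idT; elim/mpoly_subring: v => [a|i|p q IHp IHq|p q IHp IHq].
- by rewrite fC subrr; case: idT.
- rewrite fX; case: ifP => [iT|_]; last by rewrite subrr; case: idT.
  by rewrite subr0; exact: var_idealX.
- by rewrite rmorphD opprD addrACA; exact: TD.
- rewrite rmorphM.
  have -> : p * q - f p * f q = q * (p - f p) + f p * (q - f q) by ring.
  by apply: TD; apply: TM.
Qed.

Lemma var_ideal_prime T : prime_ideal (var_ideal T).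
Proof.
have [f [fT fX]] := var_ideal_ker T; apply/prime_idealP; split.
- exact: ideal_gen_is_ideal.
- by move=> /fT /eqP; rewrite rmorph1 oner_eq0.
- move=> u v /fT /eqP; rewrite rmorphM mulf_eq0 => /orP[] /eqP h; [left|right]; exact/fT.
Qed.

Lemma var_ideal_memX T i : var_ideal T 'X_i <-> i \in T.
Proof.
split; last exact: var_idealX; have [f [fT fX]] := var_ideal_ker T.
move=> /fT; rewrite fX; case: ifP => // _ /eqP.
by rewrite -msize_poly_eq0 msizeX.
Qed.

Lemma prime_monomial P (m : 'X_{1..r}) : prime_ideal P -> P 'X_[m] ->
  exists i, (0 < m i)%N /\ P 'X_i.
Proof.
move=> pP; rewrite mpolyXE_id => /(prime_ideal_prod pP) [i _ Pi].
exists i; split; last exact: prime_ideal_exp Pi.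
rewrite lt0n; apply/negP => /eqP m0; move: Pi; rewrite m0 expr0.
by case/prime_idealP: pP.
Qed.

Lemma ideal_monomial P (m : 'X_{1..r}) i : is_ideal P -> (0 < m i)%N -> P 'X_i -> P 'X_[m].
Proof.
move=> [_ _ PM] mi Pi; have -> : m = ((m - U_(i)) + U_(i))%MM.
  apply/mnmP => j; rewrite mnmDE mnmBE mnm1E subnK//.
  by case: eqP => // <-.
by rewrite mpolyXD; exact: PM.
Qed.

Definition flag T (i : nat) : {set 'I_r} := [set x in take i (enum T)]%SET.

Lemma flagS T i : (i < #|T|)%N -> exists x, [/\ x \in T, x \notin flag T i,
  x \in flag T i.+1 & flag T i \subset flag T i.+1].
Proof.
move=> iT; have sT : (i < size (enum T))%N by rewrite -cardE.
have [x0 _] : exists x0, x0 \in T by apply/card_gt0P; exact: leq_trans iT.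
pose x := nth x0 (enum T) i.
have tE : take i.+1 (enum T) = rcons (take i (enum T)) x by rewrite (take_nth x0).
exists x; split.
- by rewrite -mem_enum mem_nth.
- have := enum_uniq (mem T); rewrite -{1}(cat_take_drop i.+1 (enum T)) tE.
  by rewrite cat_uniq rcons_uniq -andbA inE => /and3P[].
- by rewrite inE tE mem_rcons mem_head.
- by apply/fintype.subsetP => y; rewrite !inE tE mem_rcons inE => ->; rewrite orbT.
Qed.

Lemma flag_sub T i : flag T i \subset T.
Proof. by apply/fintype.subsetP => x; rewrite inE => /mem_take; rewrite mem_enum. Qed.

Lemma flag_full T : flag T #|T| = T.
Proof. by apply/finset.setP => x; rewrite inE cardE take_size mem_enum. Qed.

(** The variable ideals of the proper members of the flag form the chain; P itself is put on top, as
    it may be larger than the ideal of T. *)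
Lemma height_ge_vars P T : prime_ideal P -> (forall i, i \in T -> P 'X_i) ->
  height_ge [set 0] P #|T|.
Proof.
move=> pP TP; have /prime_idealP [idP _ _] := pP.
exists (fun i => if (i < #|T|)%N then var_ideal (flag T i) else P); split.
- by rewrite ltnn.
- move=> i _; case: ifP => _; split=> //; first exact: var_ideal_prime.
    by move=> _ ->; case: (var_ideal_is_ideal (flag T i)).
  by move=> _ ->; case: idP.
- move=> i iT; rewrite iT; have [x [xT nx xS sub]] := flagS iT; split; last first.
    move=> h; suff /h /var_ideal_memX : (if (i.+1 < #|T|)%N
        then var_ideal (flag T i.+1) else P) 'X_x by rewrite (negbTE nx).
    by case: ifP => _; [exact: var_idealX|exact: TP].
  case: ifP => _; apply: var_ideal_min => //; first exact: ideal_gen_is_ideal.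
    by move=> j jT; apply: var_idealX; exact: (fintype.subsetP sub).
  by move=> j jT; apply: TP; exact: (fintype.subsetP (flag_sub T i)).
Qed.

(** A chain ending at the ideal of T is prolonged by the complementary variables to the ideal of all
    variables, and [height_le_nvars] bounds the total length by r. *)
Lemma height_ge_var_ideal J T h : height_ge J (var_ideal T) h -> (h <= #|T|)%N.
Proof.
move=> hT; suff /height_le_nvars : height_ge J (var_ideal [set: 'I_r]%SET) (h + #|~: T|).
  by have := cardsC T; rewrite card_ord; lia.
pose F i := T :|: flag (~: T) i.
apply: (@height_ge_cat _ _ [set 0] _ _ _ (fun i => var_ideal (F i))).
- rewrite (_ : F 0%N = T)//; apply/finset.setP => x.
  by rewrite !inE take0 orbF.
- by rewrite /F flag_full finset.setUCr.
- move=> i _; split; first exact: var_ideal_prime.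
  by move=> _ ->; case: (var_ideal_is_ideal (F i)).
- move=> i iT; have [x [xT nx xS sub]] := flagS iT; split.
    apply: var_ideal_min => [|j]; first exact: ideal_gen_is_ideal.
    by move=> jF; apply: var_idealX; apply: fintype.subsetP jF; exact: finset.setUS.
  move=> /(_ 'X_x); rewrite !var_ideal_memX !inE.
  move: xT nx xS; rewrite !inE => /negbTE -> /negbTE -> -> h'.
  by have := h' isT.
Qed.

End VariableIdeals.

Section MonomialIdeals.
Variables (k : fieldType) (n : nat) (O : Mon n).
Local Notation S := {mpoly k[nvars O]}.
Local Notation I := (@label_ideal n k O).

(** The transversals of the supports of the labels; each yields a prime generated by variables that
    contains the label ideal. *)
Definition hits (T : {set 'I_(nvars O)}) : Prop :=
  forall i : 'I_n, exists2 p, p \in T & (0 < label O i p)%N.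

Lemma label_ideal_sub (P : set S) : is_ideal P ->
  I `<=` P <-> forall i, P 'X_[label O i].
Proof.
move=> idP; split=> [IP i|PX]; first by apply: IP; apply: sub_ideal_gen; exists i.
by apply: ideal_gen_min => // _ [i _ <-].
Qed.

Lemma hits_var_ideal T : hits T -> I `<=` var_ideal T.
Proof.
move=> hT; apply/label_ideal_sub; first exact: var_ideal_is_ideal.
move=> i; have [p pT lp] := hT i.
by apply: (@ideal_monomial k _ (var_ideal T) _ p) => //; [exact: var_ideal_is_ideal|exact: var_idealX].
Qed.

Lemma prime_hits (P : set S) : prime_ideal P -> I `<=` P ->
  hits [set p | `[< P 'X_p >]]%SET.
Proof.
move=> pP; have /prime_idealP [idP _ _] := pP.
move=> /(label_ideal_sub idP) IP i; have [p [lp Pp]] := prime_monomial pP (IP i).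
by exists p => //; rewrite inE; exact/asboolP.
Qed.

(** A prime over I contains a variable of each label, hence the ideal of a transversal T, whose
    height is #|T|. This makes the codimension comparable across labellings. *)
Lemma codim_eqP c : codim_eq I c <->
  (exists T, hits T /\ #|T| = c) /\ forall T, hits T -> (c <= #|T|)%N.
Proof.
split=> [[[P [pP IP [hP maxP]]] minP]|[[T [hT Tc]] minT]].
  have minT T : hits T -> (c <= #|T|)%N.
    move=> hT; apply: height_ge_var_ideal; apply: minP; last exact: hits_var_ideal.
    exact: var_ideal_prime.
  split=> //; pose T := [set p | `[< P 'X_p >]]%SET.
  have hT : hits T by exact: prime_hits.
  exists T; split=> //; apply/eqP; rewrite eqn_leq minT// andbT; apply: maxP.
  by apply: height_ge_vars => // i; rewrite inE => /asboolP.
have h0 P : prime_ideal P -> I `<=` P -> height_ge [set 0] P c.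
  move=> pP IP; apply: (height_ge_le (minT _ (prime_hits pP IP))).
  by apply: height_ge_vars => // i; rewrite inE => /asboolP.
split=> //; exists (var_ideal T); split.
- exact: var_ideal_prime.
- exact: hits_var_ideal.
- split; last by move=> h'; rewrite -Tc; exact: height_ge_var_ideal.
  by apply: h0; [exact: var_ideal_prime|exact: hits_var_ideal].
Qed.

(** With r = [nvars O], height and depth at P are both r - c. A regular sequence of that length
    comes from [depth_of_resolution]; none is longer than the height, and a chain over I continues
    downwards by c steps below its first prime, so its length is at most r - c. *)
Lemma cohen_macaulay_of_resolution c (B : nat -> finType)
    (D : forall i, B i -> B i.+1 -> S) (b0 : B 0) : codim_eq I c ->
  (forall i (u : B i.+2 -> S) G, bdry D (bdry D u) G = 0) ->
  (forall i, exact_mod D [set 0] i) ->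
  (forall j, (c < j)%N -> B j -> False) ->
  (forall b : B 0, b = b0) ->
  (forall u : B 0 -> S,
    (exists w : B 1 -> S, forall G, bdry D w G = u G) <-> I (u b0)) ->
  cohen_macaulay_quot I.
Proof.
move=> cod bdry2 ex Bc B0 imE P mP IP.
have pP := maximal_prime mP; have /prime_idealP [idP P1 _] := pP.
have idI : is_ideal I := ideal_gen_is_ideal _.
have cr : (c <= nvars O)%N.
  have [[T [_ <-]] _] := (codim_eqP c).1 cod.
  by rewrite -[X in (_ <= X)%N](card_ord (nvars O)) max_card.
have [f [fr fP freg]] := maximal_wregular mP.
have nS := @noetherian_mpoly _ (nvars O) (@noetherian_field k).
have [|g [gs gP]] := depth_of_resolution bdry2 nS idI idP B0 imE
  (@is_ideal0 _) fP freg ex Bc; first by rewrite fr.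
rewrite (_ : ideal_plus I [set 0] = I); last first.
  apply/seteqP; split=> x; first by move=> [a Ia /eqP]; rewrite subr_eq0 => /eqP ->.
  by move=> Ix; exists x => //; rewrite /= subrr.
rewrite fr in gs => greg.
have bound h : height_ge I P h -> (h <= nvars O - c)%N.
  move=> [C [CP Cp CS]].
  suff /height_le_nvars : height_ge [set 0] P (c + h) by lia.
  apply: (@height_ge_cat _ _ [set 0] _ _ _ C) => //.
    by have [pC IC] := Cp 0%N isT; exact: cod.2.
  move=> i ih; have [pC _] := Cp i ih; split=> // _ ->.
  by case/prime_idealP: pC => -[].
exists (nvars O - c)%N; split; split=> //.
- by rewrite -gs; exact: wregular_height.
- exists g; split=> //; apply/regular_seqP => //; split=> // h; apply: P1.
  by move: h; apply: ideal_gen_min => // x [/IP|/gP].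
- move=> g' g'P /(regular_seqP _ idI) [g'reg _].
  by apply: bound; exact: wregular_height.
Qed.

End MonomialIdeals.

(** * Cellular complexes of monomial labellings *)

Lemma mcoeffXM (R : comNzRingType) (n : nat) (p : {mpoly R[n]}) (a b : 'X_{1..n}) :
  ('X_[a] * p)@_b = if (a <= b)%MM then p@_(b - a)%MM else 0.
Proof.
case: ifP => [ab|nab]; rewrite mulrC; first by rewrite -{1}(submK ab) addmC mcoeffMX.
apply/eqP; rewrite mcoeff_eq0 (perm_mem (msuppMX _ _)); apply/negP => /mapP [m' _ e].
by move: nab; rewrite e lem_addr.
Qed.

Lemma submBB (n : nat) (a b m : 'X_{1..n}) :
  (a <= b)%MM -> (m - a - (b - a) = m - b)%MM.
Proof.
move=> /mnm_lepP ab; apply/mnmP => p; rewrite !mnmBE; have := ab p.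
by move: (a p) (b p) (m p) => x y z; lia.
Qed.

Lemma submB_le (n : nat) (a b m : 'X_{1..n}) :
  (a <= b)%MM -> (a <= m)%MM -> (b - a <= m - a)%MM = (b <= m)%MM.
Proof.
move=> /mnm_lepP ab /mnm_lepP am.
apply/mnm_lepP/mnm_lepP => h p; have := h p; have := ab p; have := am p;
  by rewrite !mnmBE; move: (a p) (b p) (m p) => x y z; lia.
Qed.

Section Cellular.
Variables (k : fieldType) (R : realType) (n : nat) (X : regular_cell_complex R).
Variables (v : 'I_n -> cell X) (sgn : face X -> face X -> int).

Lemma is_face_trans (H G F : face X) : is_face H G -> is_face G F -> is_face H F.
Proof. by move=> /asboolP HG /asboolP GF; apply/asboolP; exact: subset_trans GF. Qed.

(** The differential of the augmented cellular chain complex of X over k, with the empty face in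
    rank 0. *)
Definition kbdry i (z : rank_face X i.+1 -> k) (G : rank_face X i) : k :=
  \sum_(F | facet (val G) (val F)) (sgn (val G) (val F))%:~R * z F.

(* D plays the role of the subcomplex of faces whose label divides a given monomial. *)
Definition supported (D : pred (face X)) i (z : rank_face X i -> k) :=
  forall F, ~~ D (val F) -> z F = 0.

Definition kexact (D : pred (face X)) := forall i (z : rank_face X i.+1 -> k),
  supported D z -> ((forall G, kbdry z G = 0) <->
    exists y : rank_face X i.+2 -> k, supported D y /\ forall F, kbdry y F = z F).

Section Labels.
Variable O : Mon n.
Local Notation S := {mpoly k[nvars O]}.
Local Notation flabel := (face_label v O).

Lemma face_labelE F p :
  flabel F p = (\max_(i < n | is_face (Some (v i)) F) label O i p)%N.
Proof.
rewrite /face_label (big_morph (fun m : 'X_{1..nvars O} => m p) (id1 := 0%N) (op1 := maxn))//.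
- by move=> m1 m2; rewrite mnmE.
- exact: mnm0E.
Qed.

Lemma face_label_le F m : (flabel F <= m)%MM =
  [forall i, is_face (Some (v i)) F ==> (label O i <= m)%MM].
Proof.
apply/mnm_lepP/forallP => [h i|h p].
  apply/implyP => iF; apply/mnm_lepP => p; apply: leq_trans (h p).
  by rewrite face_labelE (bigD1 i) //= leq_maxl.
rewrite face_labelE; apply/bigmax_leqP => i iF.
by have /implyP /(_ iF) /mnm_lepP := h i.
Qed.

Lemma face_label_facet G F : facet G F -> (flabel G <= flabel F)%MM.
Proof.
move=> /andP[GF _]; rewrite face_label_le; apply/forallP => i; apply/implyP => iG.
have := face_label_le F (flabel F); rewrite lepm_refl => /esym /forallP /(_ i) /implyP.
by apply; exact: is_face_trans GF.
Qed.

(** The degree m part of the cellular complex has a basis element x^m / m_F for each face F whose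
    label divides m. [monl] embeds coordinate vectors as homogeneous chains; [strand] reads the
    coordinates off. *)
Definition monl (m : 'X_{1..nvars O}) i (z : rank_face X i -> k) : chain k X O i :=
  [ffun F => if (flabel (val F) <= m)%MM then z F *: 'X_[m - flabel (val F)] else 0].

Definition strand (m : 'X_{1..nvars O}) i (u : chain k X O i) (F : rank_face X i) : k :=
  if (flabel (val F) <= m)%MM then (u F)@_(m - flabel (val F)) else 0.

Definition div_face (m : 'X_{1..nvars O}) : pred (face X) := fun F => (flabel F <= m)%MM.

Lemma strand_supported m i (u : chain k X O i) : supported (div_face m) (strand m u).
Proof. by move=> F /negbTE; rewrite /strand /div_face => ->. Qed.

Lemma strand_monl m i (z : rank_face X i -> k) : supported (div_face m) z ->
  strand m (monl m z) =1 z.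
Proof.
move=> sz F; rewrite /strand ffunE.
case: (boolP (flabel (val F) <= m)%MM) => [le|/sz //].
by rewrite mcoeffZ mcoeffX eqxx mulr1.
Qed.

(** The differential preserves multidegrees, since its entry x^(m_F - m_G) makes up for the
    difference of the labels. *)
Lemma strand_boundary m i (u : chain k X O i.+1) :
  strand m (boundary v sgn u) =1 kbdry (strand m u).
Proof.
move=> G; rewrite /strand /kbdry ffunE; case: ifPn => [Gm|nGm]; last first.
  rewrite big1 // => F GF; case: ifPn => [Fm|_]; last by rewrite mulr0.
  by case/negP: nGm; exact: lepm_trans (face_label_facet GF) Fm.
rewrite raddf_sum; apply: eq_bigr => F GF; have le := face_label_facet GF.
rewrite /= -(rmorph_int (@mpolyC (nvars O) k)) -mulrA mcoeffCM mcoeffXM.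
by rewrite (submB_le le Gm) (submBB _ le).
Qed.

Lemma strand_inj i (u w : chain k X O i) :
  (forall m, strand m u =1 strand m w) -> u = w.
Proof.
move=> uw; apply/ffunP => F; apply/mpolyP => e.
by have := uw (e + flabel (val F))%MM F; rewrite /strand lem_addl addmK.
Qed.

Lemma strand_monl_neq m m' i (z : rank_face X i -> k) F : m' != m ->
  strand m' (monl m z) F = 0.
Proof.
move=> ne; rewrite /strand ffunE.
case: ifP => // le'; case: ifP => [le|_]; last exact: mcoeff0.
rewrite mcoeffZ mcoeffX; case: eqP => [e|_]; last by rewrite mulr0.
by case/eqP: ne; rewrite -(submK le') -e submK.
Qed.

Lemma monl_boundary m i (z : rank_face X i.+1 -> k) : supported (div_face m) z ->
  boundary v sgn (monl m z) = monl m (kbdry z).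
Proof.
move=> sz; apply: strand_inj => m' G.
have [->|ne] := eqVneq m' m.
  rewrite strand_boundary /kbdry.
  rewrite {2}/strand ffunE /kbdry.
  case: (boolP (flabel (val G) <= m)%MM) => [le|nle].
    rewrite mcoeffZ mcoeffX eqxx mulr1; apply: eq_bigr => F _.
    by rewrite strand_monl.
  apply: big1 => F GF; rewrite strand_monl// sz ?mulr0//; apply: contra nle.
  exact: lepm_trans (face_label_facet GF).
rewrite strand_monl_neq// strand_boundary /kbdry big1// => F _.
by rewrite strand_monl_neq// mulr0.
Qed.

Lemma strand_sum (ms : seq 'X_{1..nvars O}) i (y : 'X_{1..nvars O} -> rank_face X i -> k) m F :
  uniq ms -> (forall m', supported (div_face m') (y m')) ->
  strand m (\sum_(m' <- ms) monl m' (y m')) F = if m \in ms then y m F else 0.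
Proof.
move=> us sy.
have -> : strand m (\sum_(m' <- ms) monl m' (y m')) F =
    \sum_(m' <- ms) strand m (monl m' (y m')) F.
  rewrite /strand; case: ifP => _; last by rewrite big1.
  by rewrite sum_ffunE raddf_sum.
case: ifPn => [mms|mms].
  rewrite (bigD1_seq m) //= strand_monl// big1 ?addr0// => m' ne.
  by rewrite strand_monl_neq// eq_sym.
rewrite big_seq big1// => m' m'ms; rewrite strand_monl_neq//.
by apply: contra mms => /eqP ->.
Qed.

Lemma strand_finite i (u : chain k X O i) :
  exists2 ms : seq 'X_{1..nvars O}, uniq ms & forall m F, m \notin ms -> strand m u F = 0.
Proof.
exists (undup (flatten [seq [seq (flabel (val F) + e)%MM | e <- msupp (u F)]
  | F <- enum (rank_face X i)])); first exact: undup_uniq.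
move=> m F; rewrite mem_undup /strand; case: ifP => // le nm.
apply/eqP; rewrite mcoeff_eq0; apply: contra nm => h.
apply/flattenP; exists [seq (flabel (val F) + e)%MM | e <- msupp (u F)].
  by apply: map_f; rewrite mem_enum.
by apply/mapP; exists (m - flabel (val F))%MM; rewrite // addmC submK.
Qed.

(** The positive degrees of [cellular_resolution]; degree 0 is settled by
    [cellular_augmentation]. *)
Definition cellular_exact := forall i (u : chain k X O i.+1),
  boundary v sgn u = 0 <-> exists w : chain k X O i.+2, boundary v sgn w = u.

Lemma strand0 m i F : strand m (0 : chain k X O i) F = 0.
Proof. by rewrite /strand ffunE mcoeff0 if_same. Qed.

Lemma monl0 m i (z : rank_face X i -> k) : (forall F, z F = 0) -> monl m z = 0.
Proof. by move=> z0; apply/ffunP => F; rewrite !ffunE z0 scale0r if_same. Qed.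

Lemma eq_kbdry i (z z' : rank_face X i.+1 -> k) : z =1 z' -> kbdry z =1 kbdry z'.
Proof. by move=> e G; apply: eq_bigr => F _; rewrite e. Qed.

Lemma cellular_exact_kexact m : cellular_exact -> kexact (div_face m).
Proof.
move=> ex i z sz; split=> [z0|[y [sy yz]] G].
  have /ex [w wz] : boundary v sgn (monl m z) = 0.
    by rewrite monl_boundary//; exact: monl0.
  exists (strand m w); split; first exact: strand_supported.
  by move=> F; rewrite -strand_boundary wz strand_monl.
have /ex h : exists w, boundary v sgn w = monl m z.
  exists (monl m y); rewrite monl_boundary//; congr monl; exact/funext.
have := strand_boundary m (monl m z) G; rewrite h strand0 => ->.
by apply: eq_kbdry => F; rewrite strand_monl.
Qed.

(** Each strand of a cycle is a cycle over k on the faces whose label divides m, and bounds there;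
    only finitely many strands are nonzero, so the lifts add up to a chain. *)
Lemma kexact_cellular_exact : (forall m, kexact (div_face m)) -> cellular_exact.
Proof.
move=> ex i u; split=> [u0|[w <-]].
  have zu m G : kbdry (strand m u) G = 0 by rewrite -strand_boundary u0 strand0.
  have [y yP] := choice (fun m => (ex m i _ (@strand_supported m _ u)).1 (zu m)).
  have [ms ums msP] := strand_finite u.
  have sy m : supported (div_face m) (y m) by case: (yP m).
  exists (\sum_(m <- ms) monl m (y m)); apply: strand_inj => m G.
  rewrite strand_boundary (eq_kbdry (fun F => strand_sum m F ums sy)).
  case: (boolP (m \in ms)) => [_|nms]; first by case: (yP m) => _ ->.
  by rewrite msP//; apply: big1 => F _; rewrite mulr0.
apply: strand_inj => m G; rewrite strand_boundary strand0.
apply: (ex m i (strand m (boundary v sgn w)) (@strand_supported m _ _)).2.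
exists (strand m w); split; first exact: strand_supported.
by move=> F; rewrite strand_boundary.
Qed.

End Labels.

(** Exactness only sees the subcomplexes cut out by monomials, so it passes to O' when each of its
    subcomplexes occurs for O. *)
Lemma cellular_exact_transfer (O O' : Mon n) :
  (forall m' : 'X_{1..nvars O'}, exists m : 'X_{1..nvars O},
     forall F, (face_label v O' F <= m')%MM = (face_label v O F <= m)%MM) ->
  cellular_exact O -> cellular_exact O'.
Proof.
move=> le ex; apply: kexact_cellular_exact => m'; have [m mm'] := le m'.
have -> : div_face m' = div_face m by apply/funext.
exact: cellular_exact_kexact.
Qed.

Lemma irrelevant_ideal_mcoeff0 (O : Mon n) (p : {mpoly k[nvars O]}) :
  irrelevant_ideal p -> p@_0%MM = 0.
Proof.
move=> [s [sX ->]]; rewrite raddf_sum big_seq big1// => t /sX [i _ <-].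
by rewrite /= mulrC mcoeffXM; case: ifP => // /mnm_lepP /(_ i); rewrite mnm1E eqxx mnm0E.
Qed.

(** The nonzero entries of the differential are x^(m_F - m_G) up to sign, and such a monomial lies
    in the irrelevant ideal exactly when the two labels differ. *)
Lemma minimal_complexP (O : Mon n) : incidence_function sgn ->
  minimal_complex k v sgn O <->
  forall G F, facet G F -> face_label v O G <> face_label v O F.
Proof.
move=> [sgn1 sgn0 _ _]; split=> [mc G F GF eGF|ne r i u G].
  have rF : face_rank F = (face_rank G).+1 by case/andP: GF => _ /eqP.
  pose G' : rank_face X (face_rank G) := exist _ G (eqxx _).
  pose F' : rank_face X (face_rank G).+1 := exist _ F (introT eqP rF).
  have /irrelevant_ideal_mcoeff0 := mc _ [ffun F => (F == F')%:R] G'.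
  rewrite ffunE (bigD1 F') //= ffunE eqxx mulr1 big1 ?addr0; last first.
    by move=> F1 /andP[_ /negbTE ne]; rewrite ffunE ne mulr0.
  rewrite eGF -(rmorph_int (@mpolyC (nvars O) k)) mcoeffCM mcoeffX.
  have -> : (face_label v O F - face_label v O F == 0)%MM.
    by apply/eqP/mnmP => p; rewrite mnmBE subnn mnm0E.
  rewrite mulr1; have := sgn1 G F; have := sgn0 G F; rewrite GF.
  rewrite !inE => s0 /or3P[] /eqP e; move: s0; rewrite e ?eqxx// => _ /eqP.
  - by rewrite rmorphN1 oppr_eq0 oner_eq0.
  - by rewrite oner_eq0.
rewrite ffunE; apply: is_ideal_sum; first exact: ideal_gen_is_ideal.
move=> F GF; have [_ _ IM] := ideal_gen_is_ideal
  (range (fun p : 'I_(nvars O) => 'X_p : {mpoly k[nvars O]})).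
rewrite mulrAC; apply: IM.
have : exists p, (0 < (face_label v O (val F) - face_label v O (val G))%MM p)%N.
  apply: contrapT => np; apply: (ne _ _ GF); apply/mnmP => p.
  have /mnm_lepP /(_ p) le := face_label_facet O GF.
  apply/eqP; rewrite eqn_leq le /= -subn_eq0 -leqn0 leqNgt; apply/negP => lt.
  by apply: np; exists p; rewrite mnmBE.
move=> [p lt].
refine (ideal_monomial _ lt _); first exact: ideal_gen_is_ideal.
by apply: sub_ideal_gen; exists p.
Qed.

End Cellular.

(** * Vertices and the augmentation of the cellular complex *)

Section CellularAugmentation.
Variables (k : fieldType) (R : realType) (n : nat) (X : regular_cell_complex R).
Variables (v : 'I_n -> cell X) (sgn : face X -> face X -> int).
Hypotheses (hv : vertex_identification v) (hsgn : incidence_function sgn).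

(** A ball of dimension 0 equals its interior, so a vertex contained in another puts one point in
    two open cells, which must coincide. *)
Lemma vertex_face i j : is_face (Some (v i)) (Some (v j)) -> i = j.
Proof.
have [vinj vdim] := hv.
have d0 l : cell_dim (v l) = 0%N by apply/vdim; exists l.
have ball d (x : 'rV[R]_d) : d = 0%N -> \sum_j x 0 j ^+ 2 < 1.
  by move=> d_0; subst d; rewrite big_ord0 ltr01.
move=> /asboolP /= ij; apply: vinj.
pose p := cell_map (e := v i) 0.
have [y _ yp] : (cell_map (e := v j) @` @closed_ball1 R (cell_dim (v j))) p.
  by apply: ij; exists 0 => //; rewrite /closed_ball1 /= ltW// ball.
have [e [_ eP]] := cell_partition p.
rewrite -(eP (v i)); last by exists 0 => //; rewrite /open_ball1 /= ball.
by rewrite -(eP (v j)) //; exists y => //; rewrite /open_ball1 /= ball.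
Qed.

Lemma vertex_not_empty i : ~~ is_face (Some (v i)) (None : face X).
Proof.
apply/negP => /asboolP /= h; case: (h (cell_map (e := v i) 0)).
exists 0 => //; rewrite /closed_ball1 /= big1 ?ler01// => j _.
by rewrite mxE expr0n.
Qed.

Lemma is_face_refl (F : face X) : is_face F F.
Proof. exact/asboolP. Qed.

Lemma empty_facet (F : face X) : face_rank F = 1%N -> facet None F.
Proof. by move=> rF; rewrite /facet rF eqxx andbT; apply/asboolP. Qed.

Lemma rank0_face (b : rank_face X 0) : b = empty_face X.
Proof. by apply/val_inj; case: b => [[e|]]. Qed.

Section Labels.
Variable O : Mon n.

Lemma face_label_empty : face_label v O None = 0%MM.
Proof. by rewrite /face_label big_pred0// => i; exact/negbTE/vertex_not_empty. Qed.

Lemma face_label_vertex i : face_label v O (Some (v i)) = label O i.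
Proof.
apply/mnmP => p; rewrite face_labelE (big_pred1 i)// => j.
by apply/idP/eqP => [/vertex_face|->]; last exact: is_face_refl.
Qed.

Lemma rank1_face (F : rank_face X 1) : exists i, val F = Some (v i).
Proof.
case: F => [[e|]] //= /eqP [/hv.2 [i <-]]; by exists i.
Qed.

Lemma boundary_empty (w : chain k X O 1) : boundary v sgn w (empty_face X) =
  \sum_F 'X_[face_label v O (val F)] * w F.
Proof.
rewrite ffunE; apply: eq_big => F; first by rewrite empty_facet//; apply/eqP/(valP F).
move=> _; have [_ _ sgn1 _] := hsgn; rewrite sgn1; last exact/eqP/(valP F).
rewrite mul1r /= face_label_empty; congr ('X_[_] * _).
by apply/mnmP => p; rewrite mnmBE mnm0E subn0.
Qed.

(** Rank 0 has only the empty face and rank 1 only the vertices, so the image in degree 0 is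
    generated by the vertex labels. *)
Lemma cellular_augmentation (u : chain k X O 0) :
  (exists w : chain k X O 1, boundary v sgn w = u) <-> label_ideal (u (empty_face X)).
Proof.
have idI : is_ideal (@label_ideal n k O) := ideal_gen_is_ideal _.
split=> [[w <-]|].
  rewrite boundary_empty; apply: is_ideal_sum => // F _.
  have [i ->] := rank1_face F; rewrite face_label_vertex mulrC.
  by case: idI => _ _; apply; apply: sub_ideal_gen; exists i.
pose K : set {mpoly k[nvars O]} :=
  [set a | exists w : chain k X O 1, boundary v sgn w (empty_face X) = a].
have idK : is_ideal K.
  split.
  - by exists 0; rewrite boundary_empty big1// => F _; rewrite ffunE mulr0.
  - move=> _ _ [w <-] [w' <-]; exists (w + w'); rewrite !boundary_empty -big_split /=.
    by apply: eq_bigr => F _; rewrite ffunE mulrDr.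
  - move=> a _ [w <-]; exists [ffun F => a * w F]; rewrite !boundary_empty mulr_sumr.
    by apply: eq_bigr => F _; rewrite ffunE mulrCA.
have IK : @label_ideal n k O `<=` K.
  apply/label_ideal_sub => // i.
  have vi : face_rank (Some (v i)) == 1%N by rewrite /= eqSS; apply/eqP/hv.2; exists i.
  pose F : rank_face X 1 := exist _ (Some (v i)) vi.
  exists [ffun F' => (F' == F)%:R]; rewrite boundary_empty (bigD1 F) //=.
  rewrite ffunE eqxx mulr1 face_label_vertex big1 ?addr0// => F' ne.
  by rewrite ffunE (negbTE ne) mulr0.
move=> /IK [w wu]; exists w; apply/ffunP => G; rewrite (rank0_face G); exact: wu.
Qed.

Lemma cellular_resolutionP : cellular_resolution k v sgn O <-> cellular_exact k v sgn O.
Proof. by split=> [[]|ex] //; split=> // u; exact: cellular_augmentation. Qed.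

Lemma cellular_cohen_macaulay : cellular_exact k v sgn O ->
  codim_eq (@label_ideal n k O) (dim_plus1 X) -> cohen_macaulay_quot (@label_ideal n k O).
Proof.
move=> ex cod.
pose D i (G : rank_face X i) (F : rank_face X i.+1) : {mpoly k[nvars O]} :=
  if facet (val G) (val F) then (sgn (val G) (val F))%:~R
    * 'X_[(face_label v O (val F) - face_label v O (val G))%MM] else 0.
have bdryE i (u : rank_face X i.+1 -> {mpoly k[nvars O]}) G :
    bdry D u G = boundary v sgn (finfun u : chain k X O i.+1) G.
  rewrite ffunE [in RHS]big_mkcond; apply: eq_bigr => F _.
  by rewrite /D; case: ifP => _; rewrite ?mul0r// ffunE.
have bdryfE i (w : chain k X O i.+1) G : bdry D w G = boundary v sgn w G.
  by rewrite bdryE; congr (boundary _ _ _ _); apply/ffunP => F; rewrite ffunE.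
have finE i (u : rank_face X i.+1 -> {mpoly k[nvars O]}) :
    (finfun (bdry D u) : chain k X O i) = boundary v sgn (finfun u : chain k X O i.+1).
  by apply/ffunP => G; rewrite ffunE bdryE.
apply: (@cohen_macaulay_of_resolution k n O _ _ D (empty_face X) cod).
(* The differential squares to zero because exactness includes that boundaries are cycles. *)
- move=> i u G; rewrite bdryE; have [_ h] := ex i (finfun (bdry D u)).
  by rewrite h ?ffunE//; exists (finfun u); rewrite finE.
- move=> i u u0; have [h _] := ex i (finfun u).
  have [|w wu] := h.
    by apply/ffunP => G; rewrite -bdryE [RHS]ffunE; exact: u0.
  exists w => F; rewrite bdryfE wu ffunE; exact: subrr.
- move=> j cj [F /eqP rF]; move: cj; rewrite ltnNge => /negP; apply.
  by rewrite -rF; exact: (leq_bigmax F).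
- exact: rank0_face.
- move=> u; have := cellular_augmentation (finfun u); rewrite ffunE => <-.
  split=> [[w wu]|[w wu]].
    by exists (finfun w); apply/ffunP => G; rewrite -bdryE wu ffunE.
  by exists w => G; rewrite bdryfE wu ffunE.
Qed.

End Labels.
End CellularAugmentation.

(** * Polarization *)

(** m is the least j < d with b j, and d if there is none; it turns bounds imposed level by level
    into one exponent. *)
Lemma threshold (b : pred nat) (d : nat) : exists m, forall a, (a <= d)%N ->
  (a <= m)%N <-> forall j, (j < d)%N -> b j -> (a <= j)%N.
Proof.
have [[j0 /andP[j0d bj0]]|nb] := pselect (exists j, (j < d)%N && b j).
  have ex : exists j, (j < d)%N && b j by exists j0; rewrite j0d.
  case: (ex_minnP ex) => m /andP[md bm] mmin; exists m => a ad; split=> [am j jd bj|].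
    by apply: leq_trans am _; apply: mmin; rewrite jd.
  exact.
exists d => a ad; split=> // _ j jd bj; case: nb; exists j; by rewrite jd.
Qed.

Section Polarization.
Variables (n : nat) (O : Mon n).

Definition level (p : 'I_(nvars O)) (j : nat) : {set 'I_n} :=
  [set i | (j < label O i p)%N]%SET.

Definition level_bound : nat :=
  (\max_(x : 'I_n * 'I_(nvars O)) label O x.1 x.2)%N.

Definition levels : {set {set 'I_n}} :=
  [set A : {set 'I_n} | (A != finset.set0) &&
    [exists p, exists j : 'I_level_bound, A == level p j]]%SET.

Lemma label_bound i p : (label O i p <= level_bound)%N.
Proof. by rewrite /level_bound (bigD1 (i, p)) //= leq_maxl. Qed.

Lemma level_in i p j : (j < label O i p)%N -> level p j \in levels.
Proof.
move=> ji; rewrite inE; apply/andP; split.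
  by apply/set0Pn; exists i; rewrite inE.
have jb : (j < level_bound)%N := leq_trans ji (label_bound i p).
by apply/existsP; exists p; apply/existsP; exists (Ordinal jb).
Qed.

Lemma levelsP A : A \in levels ->
  A != finset.set0 /\ exists p (j : 'I_level_bound), A = level p j.
Proof.
rewrite inE => /andP[A0 /existsP [p /existsP [j /eqP Apj]]].
by split=> //; exists p, j.
Qed.

Definition pol_label (i : 'I_n) : 'X_{1..#|levels|} :=
  [multinom (i \in enum_val q : nat) | q < #|levels|].

Lemma level_rank i p j : (j < label O i p)%N ->
  exists q : 'I_#|levels|, enum_val q = level p j.
Proof.
by move=> /level_in lv; exists (enum_rank_in lv (level p j)); rewrite enum_rankK_in.
Qed.

(** If x_p has exponent a + 1 in label i, then i lies in [level p a], hence so does j, whose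
    exponent is then above a. *)
Lemma pol_label_le i j : (pol_label i <= pol_label j)%MM -> (label O i <= label O j)%MM.
Proof.
move=> /mnm_lepP le; apply/mnm_lepP => p.
case lip: (label O i p) => [//|a].
have [|q qa] := @level_rank i p a; first by rewrite lip.
by have := le q; rewrite !mnmE qa !inE lip ltnSn lt0b.
Qed.

Fact pol_antichain : [forall i, forall j, (i != j) ==>
  ~~ (tnth [tuple pol_label i | i < n] i <= tnth [tuple pol_label i | i < n] j)%MM].
Proof.
apply/forallP => i; apply/forallP => j; apply/implyP => ij; rewrite !tnth_mktuple.
apply/negP => /pol_label_le le; have /forallP /(_ i) /forallP /(_ j) := labels_antichain O.
by rewrite ij -/(label O i) -/(label O j) le.
Qed.

Definition pol : Mon n := MonObj pol_antichain.

Lemma label_pol i : label pol i = pol_label i.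
Proof. by rewrite /label /= tnth_mktuple. Qed.

Lemma sum_ltn (a b : nat) : (a <= b)%N -> (\sum_(j < b) (j < a) = a)%N.
Proof.
suff -> : (\sum_(j < b) (j < a) = minn a b)%N by move=> /minn_idPl.
elim: b => [|b IH]; first by rewrite big_ord0 minn0.
by rewrite big_ord_recr /= IH; lia.
Qed.

Definition pol_map (m : 'X_{1..nvars pol}) : 'X_{1..nvars O} :=
  [multinom \sum_q m q * (\sum_(j < level_bound) (level p j == enum_val q)) | p < nvars O]%N.

(** The exponent of x_p in the image of the i-th polarized label counts the j with i in [level p j],
    that is, the j below [label O i p]. *)
Lemma pol_map_morphism : Mon_morphism pol_map.
Proof.
split.
- by apply/mnmP => p; rewrite mnmE mnm0E big1// => q _; rewrite mnm0E.
- move=> m m'; apply/mnmP => p; rewrite mnmDE !mnmE -big_split /=.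
  by apply: eq_bigr => q _; rewrite mnmDE mulnDl.
- move=> i; apply/mnmP => p; rewrite mnmE label_pol -[RHS](sum_ltn (label_bound i p)).
  under eq_bigr do rewrite mnmE big_distrr /=.
  rewrite exchange_big; apply: eq_bigr => j _ /=.
  case: (boolP (j < label O i p)%N) => [ji|nji].
    have [q0 q0E] := level_rank ji.
    rewrite (bigD1 q0) //= q0E eqxx inE ji big1// => q qq0.
    case: eqP => [e|_]; last by rewrite muln0.
    by case/eqP: qq0; apply: enum_val_inj; rewrite q0E.
  rewrite big1// => q _; case: eqP => [<-|_]; last by rewrite muln0.
  by rewrite inE (negbTE nji).
Qed.

Lemma pol_squarefree : squarefree_labels pol.
Proof. by move=> i q; rewrite label_pol mnmE leq_b1. Qed.

(** The i-th polarized label divides m' exactly when i lies in no level of exponent 0 in m'. Being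
    outside [level p j] means [label O i p <= j], and [threshold] merges these bounds into the
    exponent of x_p in m. *)
Lemma pol_label_threshold (m' : 'X_{1..nvars pol}) : exists m : 'X_{1..nvars O},
  forall i, (label pol i <= m')%MM = (label O i <= m)%MM.
Proof.
pose bad p j := [exists q : 'I_#|levels|, (enum_val q == level p j) && (m' q == 0%N)].
have [f fP] := choice (fun p => threshold (bad p) level_bound).
exists [multinom f p | p < nvars O] => i; rewrite label_pol.
apply/mnm_lepP/mnm_lepP => [le p|le q].
  rewrite mnmE; apply/(fP p); first exact: label_bound.
  move=> j jb /existsP [q /andP[/eqP qj /eqP q0]]; rewrite leqNgt; apply/negP => ji.
  by have := le q; rewrite mnmE qj inE ji q0.
rewrite mnmE; case: (boolP (i \in enum_val q)) => //= iq.
rewrite lt0n; apply/negP => q0.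
have [_ [p [j qpj]]] := levelsP (enum_valP q).
have := le p; rewrite mnmE => /(fP p _ (label_bound i p)) /(_ j (ltn_ord j)).
move: iq; rewrite qpj inE ltnNge => /negP nij /(_ _) h; apply: nij; apply: h.
by apply/existsP; exists q; rewrite qpj eqxx.
Qed.

(** A transversal of the polarization maps to one of O by choosing for each level a variable that
    has it; conversely the [level p 0] with p in T form a transversal. Neither passage raises the
    cardinality. *)
Lemma hits_pol c :
  (exists T, hits (O := O) T /\ #|T| = c) /\ (forall T, hits (O := O) T -> (c <= #|T|)%N) ->
  (exists T, hits (O := pol) T /\ #|T| = c) /\ (forall T, hits (O := pol) T -> (c <= #|T|)%N).
Proof.
move=> [[T [hT Tc]] minT].
have minT' (T' : {set 'I_#|levels|}) : hits (O := pol) T' -> (c <= #|T'|)%N.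
  move=> hT'; have /choice [g gP] : forall q : 'I_#|levels|,
      exists p, exists j : 'I_level_bound, enum_val q = level p j.
    by move=> q; case: (levelsP (enum_valP q)).
  apply: leq_trans (minT (g @: T')%SET _) (leq_imset_card _ _) => i.
  have [q qT' iq] := hT' i; exists (g q); first exact: imset_f.
  have [j qj] := gP q; move: iq; rewrite label_pol mnmE qj lt0b inE.
  exact: leq_ltn_trans.
split=> //; pose T' : {set 'I_#|levels|} :=
  [set q | enum_val q \in [set level p 0 | p in T]%SET]%SET.
have hT' : hits (O := pol) T'.
  move=> i; have [p pT ip] := hT i; have [q qp] := level_rank ip.
  exists q; first by rewrite inE qp; exact: imset_f.
  by rewrite label_pol mnmE qp inE ip.
exists T'; split=> //; apply/eqP; rewrite eqn_leq minT'// andbT -Tc.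
apply: leq_trans (leq_imset_card (level^~ 0%N) T).
rewrite -(card_imset _ enum_val_inj); apply: subset_leq_card.
by apply/fintype.subsetP => _ /imsetP [q + ->]; rewrite inE.
Qed.

End Polarization.

Section PolarizedLabelling.
Variables (k : fieldType) (R : realType) (n : nat) (X : regular_cell_complex R).
Variables (v : 'I_n -> cell X) (sgn : face X -> face X -> int).
Hypotheses (hv : vertex_identification v) (hsgn : incidence_function sgn).
Variable O : Mon n.

Lemma pol_face_threshold (m' : 'X_{1..nvars (pol O)}) : exists m : 'X_{1..nvars O},
  forall F, (face_label v (pol O) F <= m')%MM = (face_label v O F <= m)%MM.
Proof.
have [m mm'] := pol_label_threshold m'; exists m => F.
by rewrite !face_label_le; apply: eq_forallb => i; rewrite mm'.
Qed.

(** Let i be a vertex of F with exponent a + 1 at x_p. If the polarized labels agree, the variable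
    of [level p a] divides that of G, so a vertex of G lies in this level and has exponent at least
    a + 1; thus the original labels agree. *)
Lemma pol_face_label_neq G F : facet G F ->
  face_label v O G <> face_label v O F -> face_label v (pol O) G <> face_label v (pol O) F.
Proof.
move=> GF ne e; apply: ne; apply/mnmP => p; apply/eqP; rewrite eqn_leq.
have /mnm_lepP -> := face_label_facet v O GF; rewrite /= !face_labelE.
apply/bigmax_leqP => i iF; case lip: (label O i p) => [//|a].
have [|q qa] := @level_rank _ O i p a; first by rewrite lip.
have iq : label (pol O) i q = 1%N by rewrite label_pol mnmE qa inE lip ltnSn.
have : (0 < face_label v (pol O) G q)%N.
  by rewrite e face_labelE (bigD1 i) //= iq leq_maxl.
rewrite face_labelE => Gq.
have [g gG] : exists2 g, is_face (Some (v g)) G & label (pol O) g q != 0%N.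
  apply: contrapT => ng; move: Gq; rewrite big1 // => g gG.
  by apply/eqP; apply: contrapT => /negP gq; apply: ng; exists g.
rewrite label_pol mnmE qa inE eqb0 negbK => ag.
by rewrite (bigD1 g) //= leq_max ag.
Qed.

Lemma pol_in_CMX : in_CMX k v sgn O -> in_CMX k v sgn (pol O).
Proof.
move=> [[_ cod] res mini].
have cod' : codim_eq (@label_ideal n k (pol O)) (dim_plus1 X).
  by apply/codim_eqP; apply: hits_pol; move/codim_eqP: cod.
have ex' : cellular_exact k v sgn (pol O).
  apply: cellular_exact_transfer pol_face_threshold _.
  exact/(cellular_resolutionP k hv hsgn).
split.
- by split; first exact: (cellular_cohen_macaulay hv hsgn ex' cod').
- exact/(cellular_resolutionP k hv hsgn).
- apply/(minimal_complexP k v _ hsgn) => G F GF; apply: pol_face_label_neq => //.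
  by apply: ((minimal_complexP k v O hsgn).1 mini).
Qed.

End PolarizedLabelling.

(** * Retracts of square free labellings and finiteness *)

Section Splitting.
Variable n : nat.

Lemma additive_mnmE a b (f : 'X_{1..a} -> 'X_{1..b}) (m : 'X_{1..a}) p :
  f 0%MM = 0%MM -> (forall m m', f (m + m')%MM = (f m + f m')%MM) ->
  f m p = (\sum_q m q * f U_(q)%MM p)%N.
Proof.
move=> f0 fD; have fMn q e : f (U_(q) *+ e)%MM p = (e * f U_(q)%MM p)%N.
  elim: e => [|e IH]; first by rewrite mulm0n f0 mnm0E.
  by rewrite mulmS fD mnmDE IH mulSn.
rewrite {1}(multinomUE_id m) (big_morph f fD f0) mnm_sumE.
by apply: eq_bigr => q _; rewrite fMn.
Qed.

Lemma var_supportE (O : Mon n) p : var_support p = [set i | (0 < label O i p)%N]%SET.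
Proof. by apply/finset.setP => i; rewrite !inE lep1mP lt0n. Qed.

Lemma var_support_pol (O : Mon n) (q : 'I_(nvars (pol O))) : var_support q = enum_val q.
Proof.
by rewrite var_supportE; apply/finset.setP => i; rewrite inE label_pol mnmE lt0b.
Qed.

(* Some variable of O' occurs in psi(x_p) and in no other psi(x_p'); hence it
   has the same support as x_p. *)
Lemma split_variable (O O' : Mon n) (phi : 'X_{1..nvars O'} -> 'X_{1..nvars O})
    (psi : 'X_{1..nvars O} -> 'X_{1..nvars O'}) (p : 'I_(nvars O)) :
  Mon_morphism phi -> Mon_morphism psi -> (forall m, phi (psi m) = m) ->
  exists q, [/\ (0 < psi U_(p)%MM q)%N,
    forall p', p' != p -> psi U_(p')%MM q = 0%N
    & forall i, label O' i q = (label O i p * psi U_(p)%MM q)%N].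
Proof.
move=> [phi0 phiD _] [psi0 psiD psil] phipsi.
have phiE m p' := additive_mnmE m p' phi0 phiD.
have psiE m q := additive_mnmE m q psi0 psiD.
(* The diagonal entry 1 of phi psi at p needs a q with both factors positive; if q also occurred in
   another psi(x_p'), an off-diagonal entry would be positive. *)
have [q [pq qp]] : exists q, (0 < psi U_(p)%MM q)%N /\ (0 < phi U_(q)%MM p)%N.
  apply: contrapT => nq; have := phiE (psi U_(p)%MM) p.
  rewrite phipsi mnm1E eqxx big1 // => q _; apply/eqP; rewrite muln_eq0.
  apply: contrapT => /negP; rewrite negb_or -!lt0n => /andP[? ?].
  by apply: nq; exists q.
have q0 p' : p' != p -> psi U_(p')%MM q = 0%N.
  move=> p'p; apply/eqP; rewrite -leqn0 leqNgt; apply/negP => p'q.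
  have := phiE (psi U_(p')%MM) p; rewrite phipsi mnm1E (negbTE p'p) (bigD1 q) //=.
  move/esym/eqP; rewrite addn_eq0 muln_eq0 => /andP[/orP[]/eqP e _].
    by move: p'q; rewrite e.
  by move: qp; rewrite e.
exists q; split=> // i; rewrite -psil psiE (bigD1 p) //= big1 ?addn0// => p' p'p.
by rewrite q0 ?muln0.
Qed.

Lemma split_squarefree (O O' : Mon n) (phi : 'X_{1..nvars O'} -> 'X_{1..nvars O})
    (psi : 'X_{1..nvars O} -> 'X_{1..nvars O'}) :
  Mon_morphism phi -> Mon_morphism psi -> (forall m, phi (psi m) = m) ->
  squarefree_labels O' -> squarefree_labels O.
Proof.
move=> mphi mpsi phipsi sq i p; have [q [pq _ qE]] := split_variable p mphi mpsi phipsi.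
by apply: leq_trans (sq i q); rewrite qE leq_pmulr.
Qed.

(** The variable q found for x_p has the support of x_p and determines p, because it occurs in no
    other psi(x_p'). *)
Lemma split_var_support (O O' : Mon n) (phi : 'X_{1..nvars O'} -> 'X_{1..nvars O})
    (psi : 'X_{1..nvars O} -> 'X_{1..nvars O'}) :
  Mon_morphism phi -> Mon_morphism psi -> (forall m, phi (psi m) = m) ->
  injective (@var_support n O') -> injective (@var_support n O).
Proof.
move=> mphi mpsi phipsi inj'.
have [g gP] := choice (fun p => split_variable p mphi mpsi phipsi).
have gV p : var_support (g p) = var_support p.
  rewrite !var_supportE; apply/finset.setP => i; rewrite !inE.
  by have [pq _ ->] := gP p; rewrite muln_gt0 pq andbT.
move=> p p' pp'; have gpp' : g p = g p' by apply: inj'; rewrite !gV.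
apply/eqP; apply: contrapT => /negP ne.
have [_ + _] := gP p; move=> /(_ p'); rewrite eq_sym => /(_ ne).
by have [+ _ _] := gP p'; rewrite gpp' => /[swap] ->.
Qed.

Lemma finite_squarefree :
  finite_set [set O : Mon n | squarefree_labels O /\ injective (@var_support n O)].
Proof.
set F := [set O | _]; have [->|/set0P [O0 _]] := eqVneq F set0; first exact: finite_set0.
pose N := #|{: {set 'I_n}}|.
(* An object is coded by its number of variables, at most N by injectivity of supports, and a table
   of its 0/1 exponents; the table is indexed by ['I_N.+1] because the type of variables depends on
   the object. *)
pose T : finType := ('I_N.+1 * {ffun 'I_n * 'I_N.+1 -> bool})%type.
pose corr (t : T) (O : Mon n) := nvars O = t.1 /\
  forall (i : 'I_n) (p : 'I_(nvars O)) (q : 'I_N.+1), (p = q :> nat) -> label O i p = t.2 (i, q).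
have corr_uniq t O O' : corr t O -> corr t O' -> O = O'.
  case: O O' => [r L ac] [r' L' ac'] [/= e h] [/= e' h'].
  have rN : (r <= N.+1)%N by rewrite e ltnW.
  have {e e'} rr' : r = r' by rewrite e e'.
  subst r'; have LL' : L = L'.
    apply: eq_from_tnth => i; apply/mnmP => p.
    have pN : (p < N.+1)%N by exact: leq_trans (ltn_ord p) rN.
    by rewrite (h i p (Ordinal pN))// (h' i p (Ordinal pN)).
  by subst L'; congr MonObj; exact: bool_irrelevance.
have [g gP] : exists g : T -> Mon n, forall t O, corr t O -> g t = O.
  have /choice [g gP] : forall t, exists O', forall O, corr t O -> O' = O.
    move=> t; have [[O' tO']|nO] := pselect (exists O', corr t O').
      by exists O' => O; exact: corr_uniq.
    by exists O0 => O tO; case: nO; exists O.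
  by exists g.
apply: (@sub_finite_set _ _ (g @` [set` enum T])).
  move=> O [sq inj].
  have rN : (nvars O < N.+1)%N by rewrite ltnS -(card_ord (nvars O)); exact: leq_card inj.
  exists (Ordinal rN, [ffun x : 'I_n * 'I_N.+1 =>
      [exists p : 'I_(nvars O), ((p : nat) == x.2) && (0 < label O x.1 p)%N]]).
    by rewrite /= mem_enum.
  apply: gP; split=> // i p q pq; rewrite ffunE /=.
  have := sq i p; case lip: (label O i p) => [|[|//]] _.
    apply/esym/eqP; rewrite eqb0; apply/existsPn => p'; apply/negP => /andP[/eqP p'q].
    by rewrite (_ : p' = p) ?lip//; apply/val_inj; rewrite /= p'q.
  apply/esym/eqP; rewrite eqb1; apply/existsP; exists p.
  by rewrite lip andbT; apply/eqP.
exact/finite_image/finite_seq.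
Qed.

End Splitting.

Theorem proposition1p8 (k : fieldType) (R : realType) (n : nat)
    (X : regular_cell_complex R) (v : 'I_n -> cell X)
    (hv : vertex_identification v)
    (sgn : face X -> face X -> int) (hsgn : incidence_function sgn) :
  finite_set [set O : Mon n | maximal_object k v sgn O] /\
  (forall O : Mon n, maximal_object k v sgn O -> in_CMX_star k v sgn O).
Proof.
have star O : maximal_object k v sgn O ->
    squarefree_labels O /\ injective (@var_support n O).
  move=> [cmO maxO]; have cmP := pol_in_CMX hv hsgn cmO.
  have mphi := pol_map_morphism O.
  have [_ [psi [mpsi phipsi]]] := maxO _ cmP _ mphi; split.
    exact: split_squarefree mphi mpsi phipsi (pol_squarefree (O := O)).
  apply: split_var_support mphi mpsi phipsi _ => q q'.
  by rewrite !var_support_pol => /enum_val_inj.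
split; first by apply: sub_finite_set (@finite_squarefree n) => O /star.
move=> O maxO; have [sq inj] := star O maxO; have [cmO _] := maxO.
by split=> //; split=> //; case: cmO.
Qed.
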